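(* Let $N\ge 1$, $h,l>0$, $\theta=(\theta_1,\theta_2,\theta_3)\in\mathbb R^3$ and $(\alpha,\beta)\in\mathbb R^2\setminus\{(0,0)\}$. Consider the scattering problem, described in the context, for a channel with $N$ identical resonators of length $l$ attached at the points $x_j=(j-1)h$, $j=1,\dots,N$, with Robin condition (parameters $\alpha,\beta$) at the vertices $u_j$ and identical vertex conditions at the vertices $v_j$, of type I or of type II, with the same parameter vector $\theta$. Let $\mu(k)=\dfrac{\beta k\tan kl-\alpha}{\beta k+\alpha\tan kl}$. (i) Suppose the vertex conditions are of type I and $\theta_1\theta_2\ne0$. Then for $k>0$ the transmission probability is $$T_N(k)=\frac{1}{1+\dfrac{(\theta_1^2-\theta_2^2)^2+\mu^2(k)\theta_3^4}{4\theta_1^2\theta_2^2}\;U_{N-1}^2\!\left(\dfrac{(\theta_1^2+\theta_2^2)\cos kh-\mu(k)\theta_3^2\sin kh}{2\theta_1\theta_2}\right)}.$$ (ii) Suppose the vertex conditions are of type II and $\theta_1\theta_2\ne0$. Then for $k>0$ the transmission probability is $$T_N(k)=\frac{1}{1+\dfrac{(\theta_1^2-\theta_2^2)^2+\mu^{-2}(k)\theta_3^4}{4\theta_1^2\theta_2^2}\;U_{N-1}^2\!\left(\dfrac{(\theta_1^2+\theta_2^2)\cos kh+\mu^{-1}(k)\theta_3^2\sin kh}{2\theta_1\theta_2}\right)}.$$ (iii) If $\theta_1\theta_2=0$, then $T_N(k)=0$ for all nonzero $k\in\mathbb R$ (for either type of vertex conditions).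
   Context: Model. The metric graph $G$ has vertices $v_1,\dots,v_N$ of degree 3, placed on the real line (the channel) at $x_j=(j-1)h$, and vertices $u_1,\dots,u_N$ of degree 1. The channel consists of the leads $e_{in}=(-\infty,0]$ (ending at $v_1$), $e_{out}=[(N-1)h,+\infty)$ (starting at $v_N$), and the segments of length $h$ between consecutive $v_j$'s. At each $v_j$ a resonator edge $(v_j,u_j)$ of length $l$ is attached, with coordinate $s\in[0,l]$, $s=0$ at $v_j$ and $s=l$ at $u_j$. At $v=v_j$, $\psi_1(v),\psi_2(v),\psi_3(v)$ denote the limits of $\psi$ at $v$ along the left channel edge, the right channel edge and the resonator edge, and $\psi_i'(v)$ the corresponding one-sided derivatives taken in the direction from $v$ into the edge (so $\psi_1'(v_j)=-\frac{d\psi}{dx}(x_j-0)$). Vertex conditions with parameter vector $\theta$. Type I: $\frac{\psi_1(v)}{\theta_1}=\frac{\psi_2(v)}{\theta_2}=\frac{\psi_3(v)}{\theta_3}$ and $\theta_1\psi_1'(v)+\theta_2\psi_2'(v)+\theta_3\psi_3'(v)=0$. Type II: $\frac{\psi_1'(v)}{\theta_1}=\frac{\psi_2'(v)}{\theta_2}=\frac{\psi_3'(v)}{\theta_3}$ and $\theta_1\psi_1(v)+\theta_2\psi_2(v)+\theta_3\psi_3(v)=0$. If some $\theta_i=0$, then the corresponding $\psi_i(v)$ (type I) or $\psi_i'(v)$ (type II) is understood to be zero. Endpoint condition at each $u_j$: $\alpha\psi+\beta\frac{d\psi}{ds}=0$ at $s=l$. Scattering solution at wavenumber $k\in\mathbb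 R\setminus\{0\}$: a function $\psi$ on $G$ with $\psi''+k^2\psi=0$ on every edge, satisfying all vertex and endpoint conditions, with $\psi(x)=e^{ikx}+r_N(k)e^{-ikx}$ on $e_{in}$ and $\psi(x)=t_N(k)e^{ikx}$ on $e_{out}$. The amplitudes $r_N(k),t_N(k)$ are uniquely determined; the transmission probability is $T_N(k)=|t_N(k)|^2$. $U_n$ are the Chebyshev polynomials of the second kind: $U_0(\xi)=1$, $U_1(\xi)=2\xi$, $U_{n+2}(\xi)=2\xi U_{n+1}(\xi)-U_n(\xi)$. $\mu$ is regarded as a meromorphic function of $k$, i.e. $\mu(k)=\frac{\beta k\sin kl-\alpha\cos kl}{\beta k\cos kl+\alpha\sin kl}$; at the positive poles of $\mu$ (in (i)) or positive zeros of $\mu$ (in (ii)) the right-hand side of the formula is understood as its limit. *)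

(* Defs.v *)
(* Stdlib world: concrete classical reals, with Coquelicot for complex-valued
   limits and derivatives. *)
From Stdlib Require Export Reals.
From Coquelicot Require Export Coquelicot.
Open Scope R_scope.

(* Edges of the graph. The channel edges are numbered from left to right:
   [Chan 0] is the incoming lead, [Chan j] with 1 <= j <= N-1 is the segment
   between v_j and v_(j+1), and [Chan N] is the outgoing lead; hence [Chan (j-1)]
   and [Chan j] are the left and right channel edges at v_j. [Res j] is the
   resonator edge (v_j, u_j). Channel edges carry the coordinate x of the real
   line, resonator edges the coordinate s in [0, l]. *)
Inductive edge : Set :=
  | Chan (j : nat)
  | Res (j : nat).

Definition vertex_pos (h : R) (j : nat) : R := (INR j - 1) * h.

Definition interior (N : nat) (h l : R) (e : edge) (x : R) : Prop :=
  match e with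
  | Chan j => (j <= N)%nat /\
      (j <> 0%nat -> vertex_pos h j < x) /\
      (j <> N -> x < vertex_pos h (S j))
  | Res j => (1 <= j <= N)%nat /\ 0 < x < l
  end.

(* A function on the graph is given edge by edge, since its limits at v_j along
   the three adjacent edges may differ. Its values outside the (closed) edges are
   irrelevant: everything below depends only on the edges themselves. *)
Definition wave : Type := edge -> R -> C.

(* Derivative of a complex-valued function of a real variable; meaningful when f
   is differentiable, which [helmholtz] requires separately. *)
Definition Derive_C (f : R -> C) (x : R) : C :=
  (Derive (fun y => Re (f y)) x, Derive (fun y => Im (f y)) x).

Definition has_derivative (f : R -> C) (x : R) : Prop :=
  @is_derive R_AbsRing C_R_NormedModule f x (Derive_C f x).

Definition helmholtz (k : R) (f : R -> C) (x : R) : Prop :=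
  has_derivative f x /\ has_derivative (Derive_C f) x /\
  (Derive_C (Derive_C f) x + RtoC (k ^ 2) * f x = 0)%C.

Definition lim_at_right (f : R -> C) (x : R) (p : C) : Prop :=
  filterlim f (at_right x) (@locally C_UniformSpace p).

Definition lim_at_left (f : R -> C) (x : R) (p : C) : Prop :=
  filterlim f (at_left x) (@locally C_UniformSpace p).

Inductive vertex_type : Set := TypeI | TypeII.

(* p1/th1 = p2/th2 = p3/th3, where th_i = 0 means that p_i = 0 and that the i-th
   ratio is dropped from the chain of equalities. *)
Definition equal_ratios (th1 th2 th3 : R) (p1 p2 p3 : C) : Prop :=
  (th1 = 0 -> p1 = RtoC 0) /\ (th2 = 0 -> p2 = RtoC 0) /\ (th3 = 0 -> p3 = RtoC 0) /\
  (th1 <> 0 -> th2 <> 0 -> (p1 / RtoC th1 = p2 / RtoC th2)%C) /\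
  (th2 <> 0 -> th3 <> 0 -> (p2 / RtoC th2 = p3 / RtoC th3)%C) /\
  (th1 <> 0 -> th3 <> 0 -> (p1 / RtoC th1 = p3 / RtoC th3)%C).

Definition weighted_sum_zero (th1 th2 th3 : R) (p1 p2 p3 : C) : Prop :=
  (RtoC th1 * p1 + RtoC th2 * p2 + RtoC th3 * p3 = 0)%C.

(* p_i are the limits of psi at v along the left channel edge, the right channel
   edge and the resonator edge, d_i the corresponding derivatives directed from v
   into the edge. *)
Definition vertex_condition (vt : vertex_type) (th1 th2 th3 : R)
    (p1 p2 p3 d1 d2 d3 : C) : Prop :=
  match vt with
  | TypeI => equal_ratios th1 th2 th3 p1 p2 p3 /\
             weighted_sum_zero th1 th2 th3 d1 d2 d3
  | TypeII => equal_ratios th1 th2 th3 d1 d2 d3 /\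
              weighted_sum_zero th1 th2 th3 p1 p2 p3
  end.

(* The sign of q1 (the limit of d psi/dx from the left) is reversed because the
   vertex condition uses the derivative directed away from v_j. *)
Definition satisfies_vertex_condition (h : R) (vt : vertex_type)
    (th1 th2 th3 : R) (psi : wave) (j : nat) : Prop :=
  let x := vertex_pos h j in
  exists p1 p2 p3 q1 q2 q3 : C,
    lim_at_left (psi (Chan (j - 1))) x p1 /\
    lim_at_right (psi (Chan j)) x p2 /\
    lim_at_right (psi (Res j)) 0 p3 /\
    lim_at_left (Derive_C (psi (Chan (j - 1)))) x q1 /\
    lim_at_right (Derive_C (psi (Chan j))) x q2 /\
    lim_at_right (Derive_C (psi (Res j))) 0 q3 /\
    vertex_condition vt th1 th2 th3 p1 p2 p3 (Copp q1) q2 q3.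

Definition satisfies_endpoint_condition (l alpha beta : R)
    (psi : wave) (j : nat) : Prop :=
  exists p q : C,
    lim_at_left (psi (Res j)) l p /\
    lim_at_left (Derive_C (psi (Res j))) l q /\
    (RtoC alpha * p + RtoC beta * q = 0)%C.

(* exp(i y) for real y *)
Definition expi (y : R) : C := (cos y, sin y).

Definition scattering_solution (N : nat) (h l : R) (vt : vertex_type)
    (th1 th2 th3 alpha beta k : R) (psi : wave) (r t : C) : Prop :=
  (forall e x, interior N h l e x -> helmholtz k (psi e) x) /\
  (forall j, (1 <= j <= N)%nat ->
     satisfies_vertex_condition h vt th1 th2 th3 psi j /\
     satisfies_endpoint_condition l alpha beta psi j) /\
  (forall x, x <= 0 ->
     psi (Chan 0) x = (expi (k * x) + r * expi (- (k * x)))%C) /\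
  (forall x, vertex_pos h N <= x ->
     psi (Chan N) x = (t * expi (k * x))%C).

(* T = |t_N(k)|^2, where t_N(k) is the transmission amplitude of a scattering
   solution: a scattering solution exists, and all of them give the value T. *)
Definition is_transmission_probability (N : nat) (h l : R) (vt : vertex_type)
    (th1 th2 th3 alpha beta k T : R) : Prop :=
  (exists (psi : wave) (r t : C),
     scattering_solution N h l vt th1 th2 th3 alpha beta k psi r t) /\
  (forall (psi : wave) (r t : C),
     scattering_solution N h l vt th1 th2 th3 alpha beta k psi r t ->
     T = Cmod t ^ 2).

(* Chebyshev polynomials of the second kind *)
Fixpoint ChebU (n : nat) (xi : R) : R :=
  match n with
  | O => 1
  | S O => 2 * xi
  | S (S p as m) => 2 * xi * ChebU m xi - ChebU p xi
  end.

(* mu = mu_num / mu_den. For k > 0 and (alpha, beta) <> (0, 0) the two have no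
   common zero (their squares add up to beta^2 k^2 + alpha^2), so the positive
   zeros and poles of mu are those of mu_num and of mu_den. *)
Definition mu_num (l alpha beta k : R) : R :=
  beta * k * sin (k * l) - alpha * cos (k * l).

Definition mu_den (l alpha beta k : R) : R :=
  beta * k * cos (k * l) + alpha * sin (k * l).

Definition mu (l alpha beta k : R) : R :=
  mu_num l alpha beta k / mu_den l alpha beta k.

(* The meromorphic function 1/mu, which is 0 at the poles of mu. *)
Definition mu_inv (l alpha beta k : R) : R :=
  mu_den l alpha beta k / mu_num l alpha beta k.

(* T is the value at k of a formula f with exceptional points the zeros of d,
   where f is understood as its (punctured) limit. *)
Definition value_or_limit (d f : R -> R) (k T : R) : Prop :=
  (d k <> 0 -> T = f k) /\
  (d k = 0 -> is_lim f (Finite k) (Finite T)).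

(* Main.v *)
Require Import Defs.
From Stdlib Require Import Lra Lia Classical IndefiniteDescription.
Open Scope R_scope.

(** On every edge a solution of the Helmholtz equation is
    a cos(kx) + b sin(kx), so it is known by its pair of amplitudes (a, b), and
    the scattering problem becomes a finite chain of linear relations between
    the amplitudes on consecutive channel edges
    ([chain_of_scattering_solution], [scattering_solution_of_chain]). The
    resonator enters these relations only through the Cauchy data at its foot,
    which the Robin condition makes proportional to (mu_den, k mu_num).

    Type II reduces to type I: the passage from psi to psi'/k exchanges values
    and slopes at the vertices, replaces mu by -1/mu, changes the sign of th1,
    and keeps the transmission amplitude ([scattering_chain_dual]).

    For type I with th1 th2 <> 0 and finite mu, crossing a vertex and then a
    segment of length h multiplies (psi, psi'/k) by a real matrix W with
    determinant 1 and trace 2 xi, xi being the argument of the Chebyshev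
    polynomial. A real unimodular matrix m that takes the incoming state
    (1 + r, i (1 - r)) to the outgoing state (z, i z) satisfies
    |z|^2 = 4 / (4 + (m11 - m22)^2 + (m12 + m21)^2)
    ([total_transfer_modulus]). By Cayley-Hamilton
    W^N = U_(N-1)(xi) W - U_(N-2)(xi), and the multiple of the identity is
    invisible to m11 - m22 and m12 + m21; hence these two quantities are
    those of W times U_(N-1)(xi), which is the formula
    ([scattering_chain_transmission]).

    If th1 th2 = 0, or if mu has a pole and th3 <> 0, the vertex relation forces
    the wave to vanish to the right of the last vertex
    ([blocking_no_transmission]); a solution supported on the incoming lead and
    the first resonator exists ([blocking_chain_exists]). Hence T = 0.

    It remains to see that at such a pole the right-hand side of the formula
    tends to 0 ([transmission_resonance_limit]). Its prefactor blows up like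
    mu^2, so it is enough that xi does not approach a zero of U_(N-1), and
    these zeros lie in (-1, 1). If sin(kh) <> 0 at the pole, xi itself tends
    to infinity. If sin(kh) = 0, the limit of xi is finite, and the sign of the
    residue of mu decides: it is always negative ([mu_pole_sign], and
    [mu_zero_sign] for -1/mu), so that -mu sin(kh) has the sign of cos(kh) near the
    pole. The two terms of xi then add up without cancellation, and |xi| >= 1 once
    |mu| is large. *)

(** * Solutions of the Helmholtz equation on one edge *)

Lemma is_derive_C_components (f : R -> C) (x : R) (d : C) :
  @is_derive R_AbsRing C_R_NormedModule f x d <->
  is_derive (fun y => Re (f y)) x (Re d) /\ is_derive (fun y => Im (f y)) x (Im d).
Proof.
  split.
  - intros H; split.
    + apply (filterdiff_comp' f (fst : C_R_NormedModule -> R_NormedModule)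
               x _ _ H (filterdiff_linear _ is_linear_fst)).
    + apply (filterdiff_comp' f (snd : C_R_NormedModule -> R_NormedModule)
               x _ _ H (filterdiff_linear _ is_linear_snd)).
  - intros [H1 H2].
    assert (L : filterdiff
      (fun t : prod_NormedModule R_AbsRing R_NormedModule R_NormedModule =>
         (fst t, snd t) : C_R_NormedModule) (locally (Re (f x), Im (f x)))
      (fun t => (fst t, snd t))).
    { apply filterdiff_linear.
      apply (is_linear_prod _ _ is_linear_fst is_linear_snd). }
    generalize (filterdiff_comp'_2 _ _ (fun a b => (a, b) : C_R_NormedModule)
                  x _ _ _ H1 H2 L).
    intros K.
    unfold is_derive.
    eapply filterdiff_ext_lin.
    + eapply filterdiff_ext; [|exact K]. intros y; unfold Re, Im; now destruct (f y).
    + intros y. reflexivity.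
Qed.

Definition harmonic (k : R) (a : C * C) (x : R) : C :=
  (fst a * RtoC (cos (k * x)) + snd a * RtoC (sin (k * x)))%C.

(** The amplitudes of psi'/k when those of psi are [a]. Working with psi'/k
    instead of psi' keeps the factor k out of all the matrices below. *)
Definition turn (a : C * C) : C * C := (snd a, (- fst a)%C).

Lemma is_derive_harmonic (k : R) (a : C * C) (x : R) :
  @is_derive R_AbsRing C_R_NormedModule (harmonic k a) x
    (RtoC k * harmonic k (turn a) x)%C.
Proof.
  destruct a as [[a1 a2] [b1 b2]].
  apply is_derive_C_components; unfold harmonic, turn, Re, Im; simpl; split.
  - auto_derive; [easy|]. ring.
  - auto_derive; [easy|]. ring.
Qed.

Lemma is_derive_C_unique (f : R -> C) (x : R) (d : C) :
  @is_derive R_AbsRing C_R_NormedModule f x d -> Derive_C f x = d.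
Proof.
  intros H; apply is_derive_C_components in H as [H1 H2].
  destruct d as [d1 d2].
  apply injective_projections; apply is_derive_unique; assumption.
Qed.

Lemma Derive_C_harmonic (k : R) (a : C * C) (x : R) :
  Derive_C (harmonic k a) x = (RtoC k * harmonic k (turn a) x)%C.
Proof. apply is_derive_C_unique, is_derive_harmonic. Qed.

Lemma harmonic_scale (k : R) (c : C) (a : C * C) (x : R) :
  harmonic k ((c * fst a)%C, (c * snd a)%C) x = (c * harmonic k a x)%C.
Proof. unfold harmonic; simpl; ring. Qed.

Lemma is_derive_C_ext_loc (f g : R -> C) (x : R) (d : C) :
  locally x (fun y => f y = g y) ->
  @is_derive R_AbsRing C_R_NormedModule f x d ->
  @is_derive R_AbsRing C_R_NormedModule g x d.
Proof. apply (is_derive_ext_loc (K := R_AbsRing) (V := C_R_NormedModule)). Qed.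

Lemma helmholtz_harmonic (k : R) (a : C * C) (x : R) :
  helmholtz k (harmonic k a) x.
Proof.
  assert (D2 : @is_derive R_AbsRing C_R_NormedModule (Derive_C (harmonic k a)) x
                 (RtoC k * (RtoC k * harmonic k (turn (turn a)) x))%C).
  { apply (is_derive_C_ext_loc
             (harmonic k ((RtoC k * fst (turn a))%C, (RtoC k * snd (turn a))%C))).
    - apply filter_forall. intros y.
      now rewrite harmonic_scale, Derive_C_harmonic.
    - generalize (is_derive_harmonic k ((RtoC k * fst (turn a))%C, (RtoC k * snd (turn a))%C) x).
      replace (harmonic k (turn ((RtoC k * fst (turn a))%C, (RtoC k * snd (turn a))%C)) x)
        with (RtoC k * harmonic k (turn (turn a)) x)%C; [easy|].
      unfold harmonic, turn; simpl; ring. }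
  split; [|split].
  - unfold has_derivative. rewrite Derive_C_harmonic. apply is_derive_harmonic.
  - unfold has_derivative. now rewrite (is_derive_C_unique _ _ _ D2).
  - rewrite (is_derive_C_unique _ _ _ D2).
    unfold harmonic, turn; simpl. rewrite !RtoC_mult. ring.
Qed.

Lemma constant_of_zero_derivative (I : R -> Prop) (g : R -> R) :
  (forall x y z, I x -> I z -> x <= y <= z -> I y) ->
  (forall x, I x -> is_derive g x 0) ->
  forall x y, I x -> I y -> g x = g y.
Proof.
  intros cvx Hg.
  assert (W : forall x y, I x -> I y -> x < y -> g x = g y).
  { intros x y Ix Iy xy. apply (eq_is_derive g); [|exact xy].
    intros t Ht. apply Hg. now apply (cvx x t y). }
  intros x y Ix Iy. destruct (Rtotal_order x y) as [L|[->|L]].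
  - now apply W.
  - reflexivity.
  - symmetry; now apply W.
Qed.

(** The two amplitudes, recovered from u and v by inverting a rotation, have zero
    derivative. The interval is given as a convex predicate, so that bounded edges
    and leads are treated alike. *)
Lemma real_oscillator (I : R -> Prop) (k : R) (u v : R -> R) :
  k <> 0 ->
  (forall x y z, I x -> I z -> x <= y <= z -> I y) ->
  (forall x, I x -> is_derive u x (v x) /\ is_derive v x (- k ^ 2 * u x)) ->
  exists A B, forall x, I x ->
    u x = A * cos (k * x) + B * sin (k * x) /\
    v x = k * (B * cos (k * x) - A * sin (k * x)).
Proof.
  intros hk cvx H.
  destruct (classic (exists x, I x)) as [[x0 I0]|no];
    [|exists 0, 0; intros x Ix; exfalso; eauto].
  pose (a := fun x => u x * cos (k * x) - v x / k * sin (k * x)).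
  pose (b := fun x => u x * sin (k * x) + v x / k * cos (k * x)).
  assert (Ha : forall x, I x -> a x = a x0).
  { intros x Ix. apply (constant_of_zero_derivative I); trivial.
    intros y Iy. destruct (H y Iy) as [Hu Hv].
    unfold a. auto_derive; [repeat split; eexists; eassumption|].
    replace (Derive (fun x => u x) y) with (v y)
      by (symmetry; apply is_derive_unique; exact Hu).
    replace (Derive (fun x => v x) y) with (- k ^ 2 * u y)
      by (symmetry; apply is_derive_unique; exact Hv).
    now field. }
  assert (Hb : forall x, I x -> b x = b x0).
  { intros x Ix. apply (constant_of_zero_derivative I); trivial.
    intros y Iy. destruct (H y Iy) as [Hu Hv].
    unfold b. auto_derive; [repeat split; eexists; eassumption|].
    replace (Derive (fun x => u x) y) with (v y)
      by (symmetry; apply is_derive_unique; exact Hu).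
    replace (Derive (fun x => v x) y) with (- k ^ 2 * u y)
      by (symmetry; apply is_derive_unique; exact Hv).
    now field. }
  exists (a x0), (b x0). intros x Ix.
  rewrite <- (Ha x Ix), <- (Hb x Ix). unfold a, b.
  assert (E := sin2_cos2 (k * x)). unfold Rsqr in E. split.
  - transitivity (u x * (sin (k * x) * sin (k * x) + cos (k * x) * cos (k * x)));
      [rewrite E|]; ring.
  - transitivity (v x * (sin (k * x) * sin (k * x) + cos (k * x) * cos (k * x)));
      [rewrite E; ring|]. now field.
Qed.

Lemma helmholtz_is_harmonic (I : R -> Prop) (k : R) (f : R -> C) :
  k <> 0 ->
  (forall x y z, I x -> I z -> x <= y <= z -> I y) ->
  (forall x, I x -> helmholtz k f x) ->
  exists a, forall x, I x ->
    f x = harmonic k a x /\ Derive_C f x = (RtoC k * harmonic k (turn a) x)%C.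
Proof.
  intros hk cvx H.
  destruct (real_oscillator I k (fun x => Re (f x)) (fun x => Re (Derive_C f x)))
    as (A1 & B1 & H1); trivial.
  { intros x Ix. destruct (H x Ix) as (D1 & D2 & E).
    apply is_derive_C_components in D1 as [D1 _], D2 as [D2 _].
    split; [exact D1|].
    replace (- k ^ 2 * Re (f x)) with (Re (Derive_C (Derive_C f) x)); [exact D2|].
    apply (f_equal (@fst R R)) in E. unfold Re. simpl in *. lra. }
  destruct (real_oscillator I k (fun x => Im (f x)) (fun x => Im (Derive_C f x)))
    as (A2 & B2 & H2); trivial.
  { intros x Ix. destruct (H x Ix) as (D1 & D2 & E).
    apply is_derive_C_components in D1 as [_ D1], D2 as [_ D2].
    split; [exact D1|].
    replace (- k ^ 2 * Im (f x)) with (Im (Derive_C (Derive_C f) x)); [exact D2|].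
    apply (f_equal (@snd R R)) in E. unfold Im. simpl in *. lra. }
  exists ((A1, A2), (B1, B2)). intros x Ix.
  destruct (H1 x Ix) as [U1 V1], (H2 x Ix) as [U2 V2].
  unfold Re, Im in *.
  split; apply injective_projections; unfold harmonic, turn; simpl in *;
    try rewrite U1; try rewrite U2; try rewrite V1; try rewrite V2; ring.
Qed.

Lemma harmonic_limit (F : (R -> Prop) -> Prop) (k : R) (c : C) (a : C * C) (x : R) (f : R -> C) :
  Filter F -> filter_le F (locally x) ->
  F (fun y => f y = (c * harmonic k a y)%C) ->
  filterlim f F (@locally C_UniformSpace (c * harmonic k a x)%C).
Proof.
  intros HF Hle E.
  apply (filterlim_ext_loc (harmonic k ((c * fst a)%C, (c * snd a)%C))).
  - revert E. apply filter_imp. intros y ->. apply harmonic_scale.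
  - rewrite <- harmonic_scale.
    apply (filterlim_filter_le_1 _ Hle).
    apply (ex_derive_continuous (K := R_AbsRing) (V := C_R_NormedModule)).
    eexists; apply is_derive_harmonic.
Qed.

(** The limits of a wave and of its derivative at the end of an edge are the
    values there of the harmonic function that the wave agrees with inside: the
    wave itself is unconstrained at the end point. *)
Lemma harmonic_limit_unique (F : (R -> Prop) -> Prop) (k : R) (c : C) (a : C * C)
    (x : R) (f : R -> C) (p : C) :
  ProperFilter F -> filter_le F (locally x) ->
  F (fun y => f y = (c * harmonic k a y)%C) ->
  filterlim f F (@locally C_UniformSpace p) -> p = (c * harmonic k a x)%C.
Proof.
  intros HF Hle E Hp.
  apply (filterlim_locally_unique (V := C_R_NormedModule) (F := F) f); [exact Hp|].
  apply harmonic_limit; trivial. apply HF.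
Qed.

(** * From the graph to a chain of amplitudes *)

(** The chain of equal ratios, with its convention for zero parameters, says
    that p is a multiple of th; this form needs no case distinction. *)
Lemma equal_ratios_iff_proportional (th1 th2 th3 : R) (p1 p2 p3 : C) :
  equal_ratios th1 th2 th3 p1 p2 p3 <->
  exists c : C, p1 = (RtoC th1 * c)%C /\ p2 = (RtoC th2 * c)%C /\ p3 = (RtoC th3 * c)%C.
Proof.
  assert (Z : forall a : R, a <> 0 -> RtoC a <> 0%C) by (intros a Ha K; now apply Ha, RtoC_inj).
  unfold equal_ratios; split.
  - intros (Z1 & Z2 & Z3 & E12 & E23 & E13).
    assert (S : forall (a : R) (p : C) (c : C),
               (a = 0 -> p = RtoC 0) -> (a <> 0 -> c = (p / RtoC a)%C) ->
               p = (RtoC a * c)%C).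
    { intros a p c H0 H1. destruct (Req_dec a 0) as [e|n].
      - rewrite (H0 e), e. ring.
      - rewrite (H1 n). field. now apply Z. }
    destruct (Req_dec th1 0) as [e1|n1].
    + destruct (Req_dec th2 0) as [e2|n2].
      * exists (p3 / RtoC th3)%C. repeat split; apply S; tauto.
      * exists (p2 / RtoC th2)%C. repeat split; apply S; tauto.
    + exists (p1 / RtoC th1)%C. repeat split; apply S; tauto.
  - intros (c & -> & -> & ->).
    split; [intros ->; ring|]. split; [intros ->; ring|]. split; [intros ->; ring|].
    split; [|split]; intros n1 n2; field; split; now apply Z.
Qed.

Lemma Cmult_opp_r (c z : C) : (c * - z = - (c * z))%C.
Proof. ring. Qed.

Lemma vertex_condition_scale_slopes (k : R) (vt : vertex_type) (th1 th2 th3 : R)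
    (p1 p2 p3 d1 d2 d3 : C) :
  k <> 0 ->
  vertex_condition vt th1 th2 th3 p1 p2 p3 d1 d2 d3 ->
  vertex_condition vt th1 th2 th3 p1 p2 p3
    (RtoC k * d1)%C (RtoC k * d2)%C (RtoC k * d3)%C.
Proof.
  intros hk. destruct vt; simpl; unfold weighted_sum_zero; intros [H1 H2].
  - split; [exact H1|].
    transitivity (RtoC k * (RtoC th1 * d1 + RtoC th2 * d2 + RtoC th3 * d3))%C; [ring|].
    rewrite H2; ring.
  - split; [|exact H2].
    apply equal_ratios_iff_proportional in H1 as (c & -> & -> & ->).
    apply equal_ratios_iff_proportional. exists (RtoC k * c)%C.
    repeat split; ring.
Qed.

(** P and Q stand for values and slopes divided by k. The number b runs over the
    solutions on the resonator, whose Cauchy data at the foot form the line spanned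
    by (den, k num). *)
Definition vertex_relation (vt : vertex_type) (th1 th2 th3 den num : R)
    (P1 Q1 P2 Q2 : C) : Prop :=
  exists b : C,
    vertex_condition vt th1 th2 th3 P1 P2 (b * RtoC den)%C (- Q1)%C Q2 (b * RtoC num)%C.

Definition channel_relation (vt : vertex_type) (th1 th2 th3 den num k x : R)
    (a a' : C * C) : Prop :=
  vertex_relation vt th1 th2 th3 den num
    (harmonic k a x) (harmonic k (turn a) x) (harmonic k a' x) (harmonic k (turn a') x).

(** The channel edge number j carries the amplitudes [a j]; the vertex between
    the edges j and j+1 is at x = j h. The values of [a 0] and [a N] are the
    amplitudes of e^(ikx) + r e^(-ikx) and of t e^(ikx). *)
Definition scattering_chain (N : nat) (h : R) (vt : vertex_type)
    (th1 th2 th3 den num k : R) (r t : C) : Prop :=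
  exists a : nat -> C * C,
    a O = ((1 + r)%C, (Ci * (1 - r))%C) /\ a N = (t, (Ci * t)%C) /\
    forall j, (j < N)%nat ->
      channel_relation vt th1 th2 th3 den num k (INR j * h) (a j) (a (S j)).

Lemma harmonic_at_0 (k : R) (a : C * C) : harmonic k a 0 = fst a.
Proof. unfold harmonic. rewrite Rmult_0_r, cos_0, sin_0. ring. Qed.

Lemma harmonic_incoming (k : R) (r : C) (x : R) :
  harmonic k ((1 + r)%C, (Ci * (1 - r))%C) x
  = (expi (k * x) + r * expi (- (k * x)))%C.
Proof.
  unfold harmonic, expi, Ci. rewrite cos_neg, sin_neg.
  apply injective_projections; simpl; ring.
Qed.

Lemma harmonic_outgoing (k : R) (t : C) (x : R) :
  harmonic k (t, (Ci * t)%C) x = (t * expi (k * x))%C.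
Proof.
  unfold harmonic, expi, Ci. apply injective_projections; simpl; ring.
Qed.

(** Used to read off the amplitudes on the leads, where the wave is prescribed. *)
Lemma harmonic_inj (k x y : R) (a a' : C * C) :
  sin (k * y - k * x) <> 0 ->
  harmonic k a x = harmonic k a' x -> harmonic k a y = harmonic k a' y -> a = a'.
Proof.
  intros hs Hx Hy. rewrite sin_minus in hs.
  assert (S : RtoC (sin (k * y) * cos (k * x) - cos (k * y) * sin (k * x)) <> 0%C)
    by (intros K; now apply hs, RtoC_inj).
  rewrite RtoC_minus, !RtoC_mult in S.
  destruct a as [A B], a' as [A' B']. unfold harmonic in Hx, Hy; simpl in Hx, Hy.
  set (cx := RtoC (cos (k * x))) in *. set (sx := RtoC (sin (k * x))) in *.
  set (cy := RtoC (cos (k * y))) in *. set (sy := RtoC (sin (k * y))) in *.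
  f_equal.
  - transitivity (((A * cx + B * sx) * sy - (A * cy + B * sy) * sx) / (sy * cx - cy * sx))%C;
      [now field|]. rewrite Hx, Hy. now field.
  - transitivity (((A * cy + B * sy) * cx - (A * cx + B * sx) * cy) / (sy * cx - cy * sx))%C;
      [now field|]. rewrite Hx, Hy. now field.
Qed.

Lemma quarter_period (k : R) : k <> 0 -> exists d, 0 < d /\ sin (k * d) <> 0.
Proof.
  intros hk. exists (PI / 2 / Rabs k). assert (P := PI_RGT_0).
  assert (A := Rabs_pos_lt k hk). split.
  - repeat apply Rdiv_lt_0_compat; lra.
  - destruct (Rcase_abs k) as [n|p].
    + rewrite (Rabs_left k n).
      replace (k * (PI / 2 / - k)) with (- (PI / 2)) by now field.
      rewrite sin_neg, sin_PI2. lra.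
    + rewrite (Rabs_right k p).
      replace (k * (PI / 2 / k)) with (PI / 2) by now field.
      rewrite sin_PI2. lra.
Qed.

Lemma at_left_le_locally (x : R) : filter_le (at_left x) (locally x).
Proof. apply filter_le_within. Qed.

Lemma at_right_le_locally (x : R) : filter_le (at_right x) (locally x).
Proof. apply filter_le_within. Qed.

Lemma at_left_interval (a x : R) (P : R -> Prop) :
  a < x -> (forall y, a < y < x -> P y) -> at_left x P.
Proof.
  intros ax H. exists (mkposreal (x - a) (proj2 (Rlt_0_minus _ _) ax)). simpl.
  intros y B L. apply H. split; [|exact L].
  unfold ball in B; simpl in B. unfold AbsRing_ball, abs, minus, plus, opp in B; simpl in B.
  apply Rabs_def2 in B. lra.
Qed.

Lemma at_right_interval (x b : R) (P : R -> Prop) :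
  x < b -> (forall y, x < y < b -> P y) -> at_right x P.
Proof.
  intros xb H. exists (mkposreal (b - x) (proj2 (Rlt_0_minus _ _) xb)). simpl.
  intros y B L. apply H. split; [exact L|].
  unfold ball in B; simpl in B. unfold AbsRing_ball, abs, minus, plus, opp in B; simpl in B.
  apply Rabs_def2 in B. lra.
Qed.

Lemma interior_convex (N : nat) (h l : R) (e : edge) (x y z : R) :
  interior N h l e x -> interior N h l e z -> x <= y <= z -> interior N h l e y.
Proof.
  destruct e as [j|j]; simpl.
  - intros (H & X & _) (_ & _ & Z) L. split; [exact H|]. split; intros n.
    + specialize (X n). lra.
    + specialize (Z n). lra.
  - intros (H & X) (_ & Z) L. split; [exact H|]. lra.
Qed.

Lemma vertex_pos_S (h : R) (j : nat) : vertex_pos h (S j) = INR j * h.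
Proof. unfold vertex_pos. rewrite S_INR. ring. Qed.

Lemma interior_left_of_vertex (N : nat) (h l : R) (j : nat) :
  0 < h -> (j < N)%nat -> at_left (INR j * h) (interior N h l (Chan j)).
Proof.
  intros hh hj. apply (at_left_interval (INR j * h - h)); [lra|].
  intros y Hy. simpl. split; [lia|]. rewrite vertex_pos_S. unfold vertex_pos.
  split; intros _; lra.
Qed.

Lemma interior_right_of_vertex (N : nat) (h l : R) (j : nat) :
  0 < h -> (j < N)%nat -> at_right (INR j * h) (interior N h l (Chan (S j))).
Proof.
  intros hh hj. apply (at_right_interval _ (INR j * h + h)); [lra|].
  intros y Hy. simpl interior. split; [lia|]. rewrite !vertex_pos_S, S_INR.
  split; intros _; lra.
Qed.

Lemma interior_resonator_start (N : nat) (h l : R) (j : nat) :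
  0 < l -> (j < N)%nat -> at_right 0 (interior N h l (Res (S j))).
Proof.
  intros hl hj. apply (at_right_interval _ l); [lra|].
  intros y Hy. simpl. split; [lia|lra].
Qed.

Lemma interior_resonator_end (N : nat) (h l : R) (j : nat) :
  0 < l -> (j < N)%nat -> at_left l (interior N h l (Res (S j))).
Proof.
  intros hl hj. apply (at_left_interval 0); [lra|].
  intros y Hy. simpl. split; [lia|lra].
Qed.

Lemma mu_sq_sum (l alpha beta k : R) :
  mu_num l alpha beta k ^ 2 + mu_den l alpha beta k ^ 2 = (beta * k) ^ 2 + alpha ^ 2.
Proof.
  unfold mu_num, mu_den. assert (E := sin2_cos2 (k * l)). unfold Rsqr in E.
  transitivity (((beta * k) ^ 2 + alpha ^ 2) *
                (sin (k * l) * sin (k * l) + cos (k * l) * cos (k * l)));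
    [|rewrite E]; ring.
Qed.

(** The Cauchy data of the resonator at its foot are never both zero. *)
Lemma mu_sq_sum_pos (l alpha beta k : R) :
  (alpha, beta) <> (0, 0) -> k <> 0 ->
  0 < mu_num l alpha beta k ^ 2 + mu_den l alpha beta k ^ 2.
Proof.
  intros hab hk. rewrite mu_sq_sum.
  destruct (Req_dec alpha 0) as [e|n].
  - assert (nb : beta <> 0) by (intros e'; apply hab; congruence).
    assert (0 < (beta * k) ^ 2) by (apply pow2_gt_0; now apply Rmult_integral_contrapositive).
    generalize (pow2_ge_0 alpha); lra.
  - generalize (pow2_gt_0 _ n) (pow2_ge_0 (beta * k)); lra.
Qed.

Lemma robin_profile_at_end (l alpha beta k : R) (A B : C) :
  (RtoC alpha * harmonic k (A, B) l + RtoC beta * (RtoC k * harmonic k (turn (A, B)) l))%C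
  = (B * RtoC (mu_den l alpha beta k) - A * RtoC (mu_num l alpha beta k))%C.
Proof.
  unfold harmonic, turn, mu_num, mu_den; simpl.
  rewrite RtoC_minus, RtoC_plus, !RtoC_mult. ring.
Qed.

(** The Robin condition is one linear equation for the two amplitudes on the
    resonator; its solutions form the line spanned by (mu_den, mu_num). *)
Lemma robin_amplitudes (l alpha beta k : R) (A B : C) :
  (alpha, beta) <> (0, 0) -> k <> 0 ->
  (B * RtoC (mu_den l alpha beta k) - A * RtoC (mu_num l alpha beta k) = 0)%C ->
  exists b : C, A = (b * RtoC (mu_den l alpha beta k))%C /\
                B = (b * RtoC (mu_num l alpha beta k))%C.
Proof.
  intros hab hk H. assert (P := mu_sq_sum_pos l alpha beta k hab hk).
  set (n := mu_num l alpha beta k) in *. set (d := mu_den l alpha beta k) in *.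
  assert (S : (RtoC n * RtoC n + RtoC d * RtoC d)%C <> 0%C).
  { rewrite <- !RtoC_mult, <- RtoC_plus. intros K. apply RtoC_inj in K. simpl in P. lra. }
  assert (E : (B * RtoC d)%C = (A * RtoC n)%C)
    by (transitivity (B * RtoC d - A * RtoC n + A * RtoC n)%C; [ring|rewrite H; ring]).
  exists ((A * RtoC d + B * RtoC n) / (RtoC n * RtoC n + RtoC d * RtoC d))%C. split.
  - transitivity ((A * RtoC d * RtoC d + (B * RtoC d) * RtoC n)
                  / (RtoC n * RtoC n + RtoC d * RtoC d))%C; [rewrite E|]; now field.
  - transitivity (((A * RtoC n) * RtoC d + B * RtoC n * RtoC n)
                  / (RtoC n * RtoC n + RtoC d * RtoC d))%C; [rewrite <- E|]; now field.
Qed.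

(** The amplitudes come from [helmholtz_is_harmonic] on the interior of each edge,
    and the one-sided limits in the vertex and endpoint conditions are evaluated
    with [harmonic_limit_unique]. *)
Lemma chain_of_scattering_solution (N : nat) (h l : R) (vt : vertex_type)
    (th1 th2 th3 alpha beta k : R) (psi : wave) (r t : C) :
  (1 <= N)%nat -> 0 < h -> 0 < l -> (alpha, beta) <> (0, 0) -> k <> 0 ->
  scattering_solution N h l vt th1 th2 th3 alpha beta k psi r t ->
  scattering_chain N h vt th1 th2 th3
    (mu_den l alpha beta k) (mu_num l alpha beta k) k r t.
Proof.
  intros hN hh hl hab hk (Hhelm & Hvert & Hin & Hout).
  destruct (functional_choice
    (fun e a => forall x, interior N h l e x ->
       psi e x = harmonic k a x /\
       Derive_C (psi e) x = (RtoC k * harmonic k (turn a) x)%C)) as [a Ha].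
  { intros e. apply (helmholtz_is_harmonic (interior N h l e)); trivial.
    - intros x y z. apply interior_convex.
    - intros x. apply Hhelm. }
  assert (Lim : forall (F : (R -> Prop) -> Prop) (x : R) (e : edge) (p q : C),
    ProperFilter F -> filter_le F (locally x) -> F (interior N h l e) ->
    filterlim (psi e) F (@locally C_UniformSpace p) ->
    filterlim (Derive_C (psi e)) F (@locally C_UniformSpace q) ->
    p = harmonic k (a e) x /\ q = (RtoC k * harmonic k (turn (a e)) x)%C).
  { intros F x e p q HF Hle Hint Hp Hq. split.
    - rewrite <- (Cmult_1_l (harmonic k (a e) x)).
      apply (harmonic_limit_unique F k 1 (a e) x (psi e)); trivial.
      revert Hint. apply filter_imp. intros y Iy. rewrite Cmult_1_l. now apply Ha.
    - apply (harmonic_limit_unique F k k (turn (a e)) x (Derive_C (psi e))); trivial.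
      revert Hint. apply filter_imp. intros y Iy. now apply Ha. }
  destruct (quarter_period k hk) as (d & hd & hsin).
  exists (fun j => a (Chan j)). split; [|split].
  - assert (E : forall x, x < 0 ->
      harmonic k (a (Chan 0)) x = harmonic k ((1 + r)%C, (Ci * (1 - r))%C) x).
    { intros x Hx. rewrite harmonic_incoming, <- Hin by lra. symmetry. apply Ha.
      simpl. split; [lia|]. split; [easy|]. intros _. unfold vertex_pos; simpl. lra. }
    apply (harmonic_inj k (- d - d) (- d)).
    + now replace (k * - d - k * (- d - d)) with (k * d) by ring.
    + apply E; lra.
    + apply E; lra.
  - assert (E : forall x, vertex_pos h N < x ->
      harmonic k (a (Chan N)) x = harmonic k (t, (Ci * t)%C) x).
    { intros x Hx. rewrite harmonic_outgoing, <- Hout by lra. symmetry. apply Ha.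
      simpl. split; [lia|]. now split. }
    apply (harmonic_inj k (vertex_pos h N + d) (vertex_pos h N + d + d)).
    + now replace (k * (vertex_pos h N + d + d) - k * (vertex_pos h N + d)) with (k * d) by ring.
    + apply E; lra.
    + apply E; lra.
  - intros j hj.
    destruct (Hvert (S j)) as [Hv He]; [lia|].
    destruct Hv as (p1 & p2 & p3 & q1 & q2 & q3 & L1 & L2 & L3 & M1 & M2 & M3 & V).
    destruct He as (p & q & L4 & M4 & W).
    rewrite vertex_pos_S in L1, L2, M1, M2. simpl Nat.sub in L1, M1. rewrite Nat.sub_0_r in L1, M1.
    destruct (Lim _ _ _ _ _ (at_left_proper_filter _) (at_left_le_locally _)
                (interior_left_of_vertex N h l j hh hj) L1 M1) as [-> ->].
    destruct (Lim _ _ _ _ _ (at_right_proper_filter _) (at_right_le_locally _)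
                (interior_right_of_vertex N h l j hh hj) L2 M2) as [-> ->].
    destruct (Lim _ _ _ _ _ (at_right_proper_filter _) (at_right_le_locally _)
                (interior_resonator_start N h l j hl hj) L3 M3) as [-> ->].
    destruct (Lim _ _ _ _ _ (at_left_proper_filter _) (at_left_le_locally _)
                (interior_resonator_end N h l j hl hj) L4 M4) as [-> ->].
    destruct (a (Res (S j))) as [A B].
    rewrite robin_profile_at_end in W.
    destruct (robin_amplitudes l alpha beta k A B hab hk W) as (b & -> & ->).
    exists b.
    apply (vertex_condition_scale_slopes (/ k)) in V; [|now apply Rinv_neq_0_compat].
    assert (K : RtoC k <> 0%C) by (intros K; now apply hk, RtoC_inj).
    rewrite RtoC_inv in V by trivial.
    assert (U : forall z : C, (/ RtoC k * (RtoC k * z))%C = z) by (intros z; now field).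
    now rewrite <- Cmult_opp_r, !U, !harmonic_at_0 in V.
Qed.

Lemma scattering_solution_of_chain (N : nat) (h l : R) (vt : vertex_type)
    (th1 th2 th3 alpha beta k : R) (r t : C) :
  0 < h -> 0 < l -> k <> 0 ->
  scattering_chain N h vt th1 th2 th3
    (mu_den l alpha beta k) (mu_num l alpha beta k) k r t ->
  exists psi, scattering_solution N h l vt th1 th2 th3 alpha beta k psi r t.
Proof.
  intros hh hl hk (a & a0 & aN & Hrel).
  destruct (functional_choice
    (fun j b => (j < N)%nat ->
       vertex_condition vt th1 th2 th3
         (harmonic k (a j) (INR j * h)) (harmonic k (a (S j)) (INR j * h))
         (b * RtoC (mu_den l alpha beta k))%C
         (- harmonic k (turn (a j)) (INR j * h))%C
         (harmonic k (turn (a (S j))) (INR j * h))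
         (b * RtoC (mu_num l alpha beta k))%C)) as [b Hb].
  { intros j. destruct (Nat.lt_ge_cases j N) as [L|L].
    - destruct (Hrel j L) as [b Hb]. now exists b.
    - exists 0%C. lia. }
  pose (coef := fun e => match e with
    | Chan j => a j
    | Res j => ((b (j - 1)%nat * RtoC (mu_den l alpha beta k))%C,
                (b (j - 1)%nat * RtoC (mu_num l alpha beta k))%C)
    end).
  assert (Lim : forall (F : (R -> Prop) -> Prop) (x : R) (e : edge),
    Filter F -> filter_le F (locally x) ->
    filterlim (harmonic k (coef e)) F (@locally C_UniformSpace (harmonic k (coef e) x)) /\
    filterlim (Derive_C (harmonic k (coef e))) F
      (@locally C_UniformSpace (RtoC k * harmonic k (turn (coef e)) x)%C)).
  { intros F x e HF Hle. split.
    - rewrite <- (Cmult_1_l (harmonic k (coef e) x)).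
      apply harmonic_limit; trivial. apply filter_forall. intros y. now rewrite Cmult_1_l.
    - apply harmonic_limit; trivial. apply filter_forall. intros y. apply Derive_C_harmonic. }
  assert (LimL : forall (x : R) (e : edge),
    lim_at_left (harmonic k (coef e)) x (harmonic k (coef e) x) /\
    lim_at_left (Derive_C (harmonic k (coef e))) x (RtoC k * harmonic k (turn (coef e)) x)%C).
  { intros x e. apply Lim; [apply at_left_proper_filter|apply at_left_le_locally]. }
  assert (LimR : forall (x : R) (e : edge),
    lim_at_right (harmonic k (coef e)) x (harmonic k (coef e) x) /\
    lim_at_right (Derive_C (harmonic k (coef e))) x (RtoC k * harmonic k (turn (coef e)) x)%C).
  { intros x e. apply Lim; [apply at_right_proper_filter|apply at_right_le_locally]. }
  exists (fun e => harmonic k (coef e)). split; [|split; [|split]].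
  - intros e x _. apply helmholtz_harmonic.
  - intros [|j] hj; [lia|]. split.
    + assert (hj' : (j < N)%nat) by lia.
      unfold satisfies_vertex_condition. cbv zeta. rewrite vertex_pos_S.
      replace (S j - 1)%nat with j by lia.
      do 6 eexists.
      split; [apply (LimL _ (Chan j))|].
      split; [apply (LimR _ (Chan (S j)))|].
      split; [apply (LimR _ (Res (S j)))|].
      split; [apply (LimL _ (Chan j))|].
      split; [apply (LimR _ (Chan (S j)))|].
      split; [apply (LimR _ (Res (S j)))|].
      generalize (vertex_condition_scale_slopes k vt th1 th2 th3 _ _ _ _ _ _ hk (Hb j hj')).
      unfold coef. replace (S j - 1)%nat with j by lia.
      now rewrite Cmult_opp_r, !harmonic_at_0.
    + do 2 eexists.
      split; [apply (LimL _ (Res (S j)))|].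
      split; [apply (LimL _ (Res (S j)))|].
      unfold coef. rewrite robin_profile_at_end. ring.
  - intros x _. unfold coef. rewrite a0. apply harmonic_incoming.
  - intros x _. unfold coef. rewrite aN. apply harmonic_outgoing.
Qed.

(** * Duality between the two types of vertex conditions *)

(** The amplitudes of -i psi'/k. The factor -i makes this an involution that
    fixes outgoing waves t e^(ikx) and sends r to -r on the incoming lead. *)
Definition dual (a : C * C) : C * C := ((- Ci * snd a)%C, (Ci * fst a)%C).

Lemma Ci_Ci (z : C) : (Ci * (Ci * z))%C = (- z)%C.
Proof. unfold Ci. apply injective_projections; simpl; ring. Qed.

Lemma dual_involutive (a : C * C) : dual (dual a) = a.
Proof.
  destruct a as [[a1 a2] [b1 b2]]. unfold dual, Ci; simpl.
  repeat apply injective_projections; simpl; ring.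
Qed.

(** Passing to -i psi'/k exchanges the roles of values and slopes. On the left
    channel edge the slope directed into the edge is the negative of the
    x-derivative, and this sign is absorbed by th1. *)
Lemma vertex_condition_dual (th1 th2 th3 : R) (p1 p2 p3 q1 q2 q3 : C) :
  vertex_condition TypeII th1 th2 th3 p1 p2 p3 (- q1)%C q2 q3 <->
  vertex_condition TypeI (- th1) th2 th3 (- Ci * q1)%C (- Ci * q2)%C (- Ci * q3)%C
    (- (Ci * p1))%C (Ci * p2)%C (Ci * p3)%C.
Proof.
  simpl. rewrite !equal_ratios_iff_proportional. unfold weighted_sum_zero. split.
  - intros [(c & E1 & E2 & E3) H]. split.
    + exists (- Ci * c)%C. rewrite RtoC_opp, E2, E3.
      replace q1 with (- (RtoC th1 * c))%C by (rewrite <- E1; ring).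
      repeat split; ring.
    + transitivity (Ci * (RtoC th1 * p1 + RtoC th2 * p2 + RtoC th3 * p3))%C;
        [rewrite RtoC_opp|rewrite H]; ring.
  - intros [(c & E1 & E2 & E3) H]. split.
    + exists (Ci * c)%C.
      assert (U : forall z : C, z = (Ci * (- Ci * z))%C).
      { intros z. transitivity (- (Ci * (Ci * z)))%C; [rewrite Ci_Ci|]; ring. }
      rewrite (U q1), (U q2), (U q3), E1, E2, E3, RtoC_opp. repeat split; ring.
    + transitivity (- Ci * (RtoC (- th1) * - (Ci * p1) + RtoC th2 * (Ci * p2)
                            + RtoC th3 * (Ci * p3)))%C; [|rewrite H; ring].
      transitivity (- (Ci * (Ci * (RtoC th1 * p1 + RtoC th2 * p2 + RtoC th3 * p3))))%C;
        [rewrite Ci_Ci|rewrite RtoC_opp]; ring.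
Qed.

Lemma harmonic_dual (k : R) (a : C * C) (x : R) :
  harmonic k (dual a) x = (- Ci * harmonic k (turn a) x)%C /\
  harmonic k (turn (dual a)) x = (Ci * harmonic k a x)%C.
Proof. unfold harmonic, dual, turn; simpl. split; ring. Qed.

Lemma channel_relation_dual (th1 th2 th3 den num k x : R) (a a' : C * C) :
  channel_relation TypeII th1 th2 th3 den num k x a a' <->
  channel_relation TypeI (- th1) th2 th3 num (- den) k x (dual a) (dual a').
Proof.
  unfold channel_relation, vertex_relation.
  destruct (harmonic_dual k a x) as [-> ->], (harmonic_dual k a' x) as [-> ->].
  split; intros [b Hb].
  - exists (- Ci * b)%C.
    apply vertex_condition_dual in Hb. rewrite RtoC_opp.
    now replace (- Ci * b * RtoC num)%C with (- Ci * (b * RtoC num))%C by ring;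
      replace (- Ci * b * - RtoC den)%C with (Ci * (b * RtoC den))%C by ring.
  - exists (Ci * b)%C. apply vertex_condition_dual.
    replace (- Ci * (Ci * b * RtoC num))%C with (b * RtoC num)%C
      by (transitivity (- (Ci * (Ci * (b * RtoC num))))%C; [rewrite Ci_Ci|]; ring).
    replace (Ci * (Ci * b * RtoC den))%C with (b * RtoC (- den))%C
      by (transitivity (Ci * (Ci * (b * RtoC den)))%C;
          [rewrite Ci_Ci, RtoC_opp|]; ring).
    exact Hb.
Qed.

Lemma scattering_chain_dual (N : nat) (h th1 th2 th3 den num k : R) (r t : C) :
  scattering_chain N h TypeII th1 th2 th3 den num k r t <->
  scattering_chain N h TypeI (- th1) th2 th3 num (- den) k (- r)%C t.
Proof.
  assert (D0 : forall z : C, dual ((1 + z)%C, (Ci * (1 - z))%C)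
                             = ((1 + - z)%C, (Ci * (1 - - z))%C)).
  { intros z. unfold dual, Ci; simpl. repeat apply injective_projections; simpl; ring. }
  assert (DN : dual (t, (Ci * t)%C) = (t, (Ci * t)%C)).
  { unfold dual, Ci; simpl. repeat apply injective_projections; simpl; ring. }
  split; intros (a & a0 & aN & H); exists (fun j => dual (a j)).
  - split; [now rewrite a0|]. split; [now rewrite aN|].
    intros j hj. now apply channel_relation_dual, H.
  - split; [rewrite a0, D0; f_equal; ring|]. split; [now rewrite aN|].
    intros j hj. apply channel_relation_dual. rewrite !dual_involutive. now apply H.
Qed.

(** * Powers of a unimodular transfer matrix *)

Definition transfer (w11 w12 w21 w22 : R) (v : C * C) : C * C :=
  ((RtoC w11 * fst v + RtoC w12 * snd v)%C, (RtoC w21 * fst v + RtoC w22 * snd v)%C).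

(** U_(n-1), with U_(-1) = 0 as the recurrence requires. *)
Definition ChebU_pred (n : nat) (xi : R) : R :=
  match n with O => 0 | S m => ChebU m xi end.

Lemma ChebU_S (n : nat) (xi : R) :
  ChebU (S n) xi = 2 * xi * ChebU n xi - ChebU_pred n xi.
Proof. destruct n; simpl; ring. Qed.

(** This is the statement that U_n(xi) W - U_(n-1)(xi) has determinant 1 when W has
    determinant 1 and trace 2 xi. *)
Lemma ChebU_quadratic (n : nat) (xi : R) :
  ChebU n xi ^ 2 - 2 * xi * ChebU n xi * ChebU_pred n xi + ChebU_pred n xi ^ 2 = 1.
Proof.
  induction n as [|n IH].
  - simpl; ring.
  - rewrite ChebU_S. simpl ChebU_pred. rewrite <- IH. ring.
Qed.

Lemma ChebU_opp (n : nat) (xi : R) : ChebU n (- xi) ^ 2 = ChebU n xi ^ 2.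
Proof.
  enough (E : ChebU n (- xi) = (-1) ^ n * ChebU n xi /\
              ChebU_pred n (- xi) = - ((-1) ^ n * ChebU_pred n xi)).
  { destruct E as [-> _]. rewrite Rpow_mult_distr, <- pow_mult, Nat.mul_comm, pow_mult.
    replace ((-1) ^ 2) with 1 by ring. rewrite pow1. ring. }
  induction n as [|n [IH1 IH2]].
  - simpl. split; ring.
  - rewrite !ChebU_S. simpl ChebU_pred. rewrite IH1, IH2. simpl pow. split; ring.
Qed.

(** For |xi| >= 1 the recurrence makes |U_n(xi)| nondecreasing in n. *)
Lemma ChebU_large (n : nat) (xi : R) : 1 <= xi ^ 2 -> 1 <= ChebU n xi ^ 2.
Proof.
  intros H.
  assert (X : 1 <= Rabs xi).
  { rewrite <- (pow2_abs xi) in H. assert (P := Rabs_pos xi). nra. }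
  enough (E : 1 <= Rabs (ChebU n xi) /\ Rabs (ChebU_pred n xi) <= Rabs (ChebU n xi)).
  { rewrite <- pow2_abs. nra. }
  induction n as [|n [IH1 IH2]].
  - simpl. rewrite Rabs_R1, Rabs_R0. lra.
  - rewrite ChebU_S. simpl ChebU_pred.
    assert (T := Rabs_triang_inv (2 * xi * ChebU n xi) (ChebU_pred n xi)).
    rewrite !Rabs_mult, (Rabs_right 2) in T by lra.
    nra.
Qed.

(** Cayley-Hamilton, W^2 = 2 xi W - 1, turns W^(n+1) into U_n W - U_(n-1). *)
Lemma transfer_power (w11 w12 w21 w22 xi : R) (L : nat -> C * C) (n : nat) :
  w11 * w22 - w12 * w21 = 1 -> w11 + w22 = 2 * xi ->
  (forall j, (j <= n)%nat -> L (S j) = transfer w11 w12 w21 w22 (L j)) ->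
  let u := ChebU n xi in let v := ChebU_pred n xi in
  L (S n) = transfer (u * w11 - v) (u * w12) (u * w21) (u * w22 - v) (L O).
Proof.
  intros hdet htr HL. cbv zeta.
  induction n as [|n IH].
  - rewrite HL by lia. simpl. f_equal; ring.
  - rewrite HL, IH by (intros; try apply HL; lia).
    rewrite ChebU_S. simpl ChebU_pred.
    set (u := ChebU n xi). set (v := ChebU_pred n xi).
    unfold transfer; simpl.
    assert (E11 : w12 * w21 = w11 * w22 - 1) by lra.
    rewrite <- !htr. destruct (L O) as [[a1 a2] [b1 b2]].
    repeat apply injective_projections; simpl; ring [E11].
Qed.

(** The incoming state at the first vertex, of amplitude 1 and reflection r, is
    carried to an outgoing state of amplitude z. *)
Definition total_transfer (m11 m12 m21 m22 : R) (r z : C) : Prop :=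
  (z, (Ci * z)%C) = transfer m11 m12 m21 m22 ((1 + r)%C, (Ci * (1 - r))%C).

(** Inverting the unimodular matrix m and adding the two components of the
    incoming state eliminates r and leaves
    ((m11 + m22) + i (m21 - m12)) z = 2. *)
Lemma total_transfer_modulus (m11 m12 m21 m22 : R) (r z : C) :
  m11 * m22 - m12 * m21 = 1 -> total_transfer m11 m12 m21 m22 r z ->
  Cmod z ^ 2 = 4 / (4 + (m11 - m22) ^ 2 + (m12 + m21) ^ 2).
Proof.
  intros hdet H. destruct r as [r1 r2], z as [z1 z2].
  rewrite Cmod2_alt. unfold Re, Im; simpl fst; simpl snd.
  unfold total_transfer, transfer, Ci in H. injection H as E1 E2 E3 E4.
  simpl in E1, E2, E3, E4.
  assert (P : 0 < 4 + (m11 - m22) ^ 2 + (m12 + m21) ^ 2)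
    by (generalize (pow2_ge_0 (m11 - m22)) (pow2_ge_0 (m12 + m21)); lra).
  (* Real and imaginary parts of ((m11 + m22) + i (m21 - m12)) z = 2. *)
  assert (S1 : (m11 + m22) * z1 - (m21 - m12) * z2 = 2).
  { transitivity (2 * (m11 * m22 - m12 * m21)); [|lra].
    assert (F1 : z1 = m11 * (1 + r1) + m12 * r2) by lra.
    assert (F2 : z2 = m11 * r2 + m12 * (1 - r1)) by lra.
    assert (F3 : - z2 = m21 * (1 + r1) + m22 * r2) by lra.
    assert (F4 : z1 = m21 * r2 + m22 * (1 - r1)) by lra.
    transitivity (m11 * z1 + m22 * z1 - m21 * z2 - m12 * - z2); [ring|].
    rewrite F3. rewrite F4 at 1. rewrite F1. rewrite F2. ring. }
  assert (S2 : (m11 + m22) * z2 + (m21 - m12) * z1 = 0).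
  { assert (F1 : z1 = m11 * (1 + r1) + m12 * r2) by lra.
    assert (F2 : z2 = m11 * r2 + m12 * (1 - r1)) by lra.
    assert (F3 : - z2 = m21 * (1 + r1) + m22 * r2) by lra.
    assert (F4 : z1 = m21 * r2 + m22 * (1 - r1)) by lra.
    transitivity (- (m11 * - z2) + m22 * z2 + m21 * z1 - m12 * z1); [ring|].
    rewrite F3. rewrite F4 at 2. rewrite F1. rewrite F2. ring. }
  assert (Q : (4 + (m11 - m22) ^ 2 + (m12 + m21) ^ 2) * (z1 ^ 2 + z2 ^ 2) = 4).
  { transitivity (((m11 + m22) * z1 - (m21 - m12) * z2) ^ 2
                  + ((m11 + m22) * z2 + (m21 - m12) * z1) ^ 2).
    - transitivity (((m11 + m22) ^ 2 + (m21 - m12) ^ 2) * (z1 ^ 2 + z2 ^ 2)); [|ring].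
      f_equal. transitivity (4 * (m11 * m22 - m12 * m21) + (m11 - m22) ^ 2 + (m12 + m21) ^ 2);
        [rewrite hdet|]; ring.
    - rewrite S1, S2; ring. }
  rewrite <- Q at 1. field. lra.
Qed.

Lemma total_transfer_exists (m11 m12 m21 m22 : R) :
  m11 * m22 - m12 * m21 = 1 -> exists r z, total_transfer m11 m12 m21 m22 r z.
Proof.
  intros hdet.
  pose (s := m11 + m22). pose (d := m21 - m12). pose (q := s ^ 2 + d ^ 2).
  assert (P : 0 < q).
  { replace q with (4 * (m11 * m22 - m12 * m21) + (m11 - m22) ^ 2 + (m12 + m21) ^ 2)
      by (unfold q, s, d; ring).
    rewrite hdet. generalize (pow2_ge_0 (m11 - m22)) (pow2_ge_0 (m12 + m21)). lra. }
  (* z = 2 / (s + i d), and r is then read from 1 + r = m22 z - i m12 z. *)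
  pose (z1 := 2 * s / q). pose (z2 := - (2 * d / q)).
  assert (S1 : s * z1 - d * z2 = 2).
  { unfold z1, z2. transitivity (2 * (s ^ 2 + d ^ 2) / q); [field; lra|]. fold q. field; lra. }
  assert (S2 : s * z2 + d * z1 = 0) by (unfold z1, z2; field; lra).
  exists (m22 * z1 + m12 * z2 - 1, m22 * z2 - m12 * z1), (z1, z2).
  unfold total_transfer, transfer, Ci.
  unfold s, d in S1, S2.
  assert (D1 : (m11 * m22 - m12 * m21) * z1 = z1) by (rewrite hdet; ring).
  assert (D2 : (m11 * m22 - m12 * m21) * z2 = z2) by (rewrite hdet; ring).
  assert (E1 : m12 * ((m11 + m22) * z1 - (m21 - m12) * z2) = m12 * 2) by now rewrite S1.
  assert (E2 : m22 * ((m11 + m22) * z1 - (m21 - m12) * z2) = m22 * 2) by now rewrite S1.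
  assert (E3 : m12 * ((m11 + m22) * z2 + (m21 - m12) * z1) = m12 * 0) by now rewrite S2.
  assert (E4 : m22 * ((m11 + m22) * z2 + (m21 - m12) * z1) = m22 * 0) by now rewrite S2.
  repeat apply injective_projections; simpl; lra.
Qed.

(** * The transmission formula for type I *)

(** The state (psi, psi'/k) at x is the pair of amplitudes rotated by kx, so free
    propagation over a segment is a rotation. *)
Definition rotate (y : R) (a : C * C) : C * C := transfer (cos y) (sin y) (- sin y) (cos y) a.

Lemma rotate_harmonic (k x : R) (a : C * C) :
  rotate (k * x) a = (harmonic k a x, harmonic k (turn a) x).
Proof.
  unfold rotate, transfer, harmonic, turn; simpl. rewrite RtoC_opp. f_equal; ring.
Qed.

Lemma transfer_transfer (v11 v12 v21 v22 w11 w12 w21 w22 : R) (a : C * C) :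
  transfer v11 v12 v21 v22 (transfer w11 w12 w21 w22 a)
  = transfer (v11 * w11 + v12 * w21) (v11 * w12 + v12 * w22)
             (v21 * w11 + v22 * w21) (v21 * w12 + v22 * w22) a.
Proof.
  unfold transfer; simpl. rewrite !RtoC_plus, !RtoC_mult. f_equal; ring.
Qed.

Lemma rotate_rotate (x y : R) (a : C * C) : rotate x (rotate y a) = rotate (x + y) a.
Proof.
  unfold rotate. rewrite transfer_transfer, cos_plus, sin_plus. f_equal; ring.
Qed.

Lemma rotate_0 (a : C * C) : rotate 0 a = a.
Proof.
  unfold rotate, transfer. rewrite cos_0, sin_0, Ropp_0. destruct a; simpl. f_equal; ring.
Qed.

Lemma rotate_outgoing (y : R) (t : C) :
  rotate y (t, (Ci * t)%C) = ((t * expi y)%C, (Ci * (t * expi y))%C).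
Proof.
  unfold rotate, transfer, expi, Ci.
  repeat apply injective_projections; simpl; ring.
Qed.

Lemma Cmod_expi (y : R) : Cmod (expi y) = 1.
Proof.
  unfold expi, Cmod; simpl.
  replace (cos y * (cos y * 1) + sin y * (sin y * 1)) with 1; [apply sqrt_1|].
  assert (E := sin2_cos2 y). unfold Rsqr in E. lra.
Qed.

Lemma RtoC_neq_0 (x : R) : x <> 0 -> RtoC x <> 0%C.
Proof. intros H K. now apply H, RtoC_inj. Qed.

(** Eliminating the common ratio c and the resonator amplitude b: the resonator
    contributes mu th3^2 c to the sum of slopes, and nothing if th3 = 0, even at a
    pole of mu. *)
Lemma vertex_relation_transfer (th1 th2 th3 den num : R) (P1 Q1 P2 Q2 : C) :
  th1 * th2 <> 0 -> den <> 0 \/ th3 = 0 ->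
  vertex_relation TypeI th1 th2 th3 den num P1 Q1 P2 Q2 <->
  (P2, Q2) = transfer (th2 / th1) 0 (- (num / den * th3 ^ 2 / (th1 * th2))) (th1 / th2)
               (P1, Q1).
Proof.
  intros h12 hd.
  assert (h1 : th1 <> 0) by (intros e; apply h12; rewrite e; ring).
  assert (h2 : th2 <> 0) by (intros e; apply h12; rewrite e; ring).
  assert (H1 := RtoC_neq_0 _ h1). assert (H2 := RtoC_neq_0 _ h2).
  set (m := num / den).
  assert (G : forall b c : C, (b * RtoC den = RtoC th3 * c)%C ->
              (RtoC th3 * (b * RtoC num) = RtoC (m * th3 ^ 2) * c)%C).
  { intros b c E. destruct (Req_dec th3 0) as [e|n3].
    - rewrite e. replace (m * 0 ^ 2) with 0 by ring. ring.
    - assert (hden : den <> 0) by tauto. assert (Hd := RtoC_neq_0 _ hden).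
      unfold m. simpl pow. rewrite Rmult_1_r, !RtoC_mult, RtoC_div by trivial.
      transitivity (RtoC th3 * ((b * RtoC den) * RtoC num / RtoC den))%C; [now field|].
      rewrite E. now field. }
  unfold vertex_relation, transfer; simpl. unfold weighted_sum_zero.
  replace (m * (th3 * (th3 * 1))) with (m * th3 ^ 2) by (simpl; ring).
  replace (RtoC (- (m * th3 ^ 2 / (th1 * th2))))
    with (- (RtoC (m * th3 ^ 2) / (RtoC th1 * RtoC th2)))%C
    by (now rewrite RtoC_opp, RtoC_div, (RtoC_mult th1 th2) by trivial).
  rewrite !RtoC_div by trivial.
  split.
  - intros (b & E & W). apply equal_ratios_iff_proportional in E as (c & E1 & E2 & E3).
    rewrite (G b c E3) in W. subst P1 P2.
    f_equal.
    + now field.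
    + transitivity ((RtoC th1 * - Q1 + RtoC th2 * Q2 + RtoC (m * th3 ^ 2) * c
        + RtoC th1 * Q1 - RtoC (m * th3 ^ 2) * c) / RtoC th2)%C; [now field|].
      rewrite W. field. now split.
  - intros E; apply pair_equal_spec in E as [-> ->].
    (* The resonator amplitude is th3 c / den; this reads 0 when th3 = 0, so that a
       vanishing den is harmless there. *)
    assert (B : (RtoC (th3 / den) * RtoC den)%C = RtoC th3).
    { rewrite <- RtoC_mult. f_equal. destruct (Req_dec th3 0) as [->|n3].
      - unfold Rdiv; ring.
      - field. tauto. }
    assert (E3 : (RtoC (th3 / den) * (P1 / RtoC th1) * RtoC den
                  = RtoC th3 * (P1 / RtoC th1))%C).
    { rewrite <- B. ring. }
    exists (RtoC (th3 / den) * (P1 / RtoC th1))%C. split.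
    + apply equal_ratios_iff_proportional. exists (P1 / RtoC th1)%C.
      split; [now field|]. split; [now field|exact E3].
    + rewrite (G _ _ E3). field. now split.
Qed.


(** The matrix is that of the vertex followed by the rotation by kh. The last
    rotation leads past the last vertex to x = N h; it only multiplies t by the
    phase e^(ikNh), and makes the total transfer an exact N-th power. *)
Lemma scattering_chain_transfer (N : nat) (h th1 th2 th3 den num k : R) (r t : C) :
  th1 * th2 <> 0 -> den <> 0 \/ th3 = 0 ->
  let a := th2 / th1 in let g := num / den * th3 ^ 2 / (th1 * th2) in
  let c := cos (k * h) in let s := sin (k * h) in
  scattering_chain N h TypeI th1 th2 th3 den num k r t <->
  exists L : nat -> C * C,
    L O = ((1 + r)%C, (Ci * (1 - r))%C) /\
    L N = ((t * expi (k * (INR N * h)))%C, (Ci * (t * expi (k * (INR N * h))))%C) /\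
    forall j, (j < N)%nat ->
      L (S j) = transfer (c * a - s * g) (s / a) (- s * a - c * g) (c / a) (L j).
Proof.
  intros h12 hd a g c s.
  assert (h1 : th1 <> 0) by (intros e; apply h12; rewrite e; ring).
  assert (h2 : th2 <> 0) by (intros e; apply h12; rewrite e; ring).
  assert (A : / a = th1 / th2) by (unfold a; now field).
  assert (W : forall v, transfer (c * a - s * g) (s / a) (- s * a - c * g) (c / a) v
                        = rotate (k * h) (transfer a 0 (- g) (th1 / th2) v)).
  { intros v. unfold rotate. rewrite transfer_transfer. fold c s. unfold Rdiv at 1 2. rewrite A.
    f_equal; ring. }
  assert (Rel : forall j (b b' : C * C),
    channel_relation TypeI th1 th2 th3 den num k (INR j * h) b b' <->
    rotate (k * (INR j * h)) b' = transfer a 0 (- g) (th1 / th2) (rotate (k * (INR j * h)) b)).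
  { intros j b b'. unfold channel_relation.
    rewrite !rotate_harmonic. apply vertex_relation_transfer; trivial. }
  split.
  - intros (amp & a0 & aN & H). exists (fun j => rotate (k * (INR j * h)) (amp j)).
    split; [|split].
    + rewrite a0. simpl INR. replace (k * (0 * h)) with 0 by ring. apply rotate_0.
    + rewrite aN. apply rotate_outgoing.
    + intros j hj. rewrite W, <- (proj1 (Rel j _ _) (H j hj)), rotate_rotate, S_INR.
      f_equal; ring.
  - intros (L & L0 & LN & H). exists (fun j => rotate (- (k * (INR j * h))) (L j)).
    split; [|split].
    + rewrite L0. simpl INR. replace (- (k * (0 * h))) with 0 by ring. apply rotate_0.
    + rewrite LN, <- rotate_outgoing, rotate_rotate, Rplus_opp_l. apply rotate_0.
    + intros j hj. apply Rel. rewrite H, W, !rotate_rotate by trivial.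
      rewrite S_INR.
      replace (k * (INR j * h) + - (k * ((INR j + 1) * h)) + k * h) with 0 by ring.
      replace (k * (INR j * h) + - (k * (INR j * h))) with 0 by ring.
      now rewrite !rotate_0.
Qed.

(** The right-hand side of the transmission formula, with the value of mu left
    free. *)
Definition transmission (N : nat) (h th1 th2 th3 m k : R) : R :=
  1 / (1 + ((th1 ^ 2 - th2 ^ 2) ^ 2 + m ^ 2 * th3 ^ 4) / (4 * th1 ^ 2 * th2 ^ 2)
           * ChebU (N - 1)
               (((th1 ^ 2 + th2 ^ 2) * cos (k * h) - m * th3 ^ 2 * sin (k * h))
                / (2 * th1 * th2)) ^ 2).

Lemma scattering_chain_transmission (N : nat) (h th1 th2 th3 den num k : R) :
  (1 <= N)%nat -> th1 * th2 <> 0 -> den <> 0 \/ th3 = 0 ->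
  (exists r t, scattering_chain N h TypeI th1 th2 th3 den num k r t) /\
  (forall r t, scattering_chain N h TypeI th1 th2 th3 den num k r t ->
     Cmod t ^ 2 = transmission N h th1 th2 th3 (num / den) k).
Proof.
  intros hN h12 hd. destruct N as [|n]; [lia|].
  assert (h1 : th1 <> 0) by (intros e; apply h12; rewrite e; ring).
  assert (h2 : th2 <> 0) by (intros e; apply h12; rewrite e; ring).
  assert (Eq := fun r t => scattering_chain_transfer (S n) h th1 th2 th3 den num k r t h12 hd).
  cbv zeta in Eq. unfold transmission. replace (S n - 1)%nat with n by lia.
  set (m := num / den) in *.
  set (xi := ((th1 ^ 2 + th2 ^ 2) * cos (k * h) - m * th3 ^ 2 * sin (k * h)) / (2 * th1 * th2)).
  set (a := th2 / th1) in *. set (g := m * th3 ^ 2 / (th1 * th2)) in *.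
  set (w11 := cos (k * h) * a - sin (k * h) * g) in *.
  set (w12 := sin (k * h) / a) in *.
  set (w21 := - sin (k * h) * a - cos (k * h) * g) in *.
  set (w22 := cos (k * h) / a) in *.
  assert (ha : a <> 0) by (unfold a; apply Rmult_integral_contrapositive; split;
                            [|apply Rinv_neq_0_compat]; trivial).
  assert (E := sin2_cos2 (k * h)). unfold Rsqr in E.
  assert (hdet : w11 * w22 - w12 * w21 = 1).
  { transitivity (sin (k * h) * sin (k * h) + cos (k * h) * cos (k * h)); [|exact E].
    unfold w11, w12, w21, w22. now field. }
  assert (htr : w11 + w22 = 2 * xi).
  { unfold w11, w22, xi, g, a. field. now split. }
  assert (Pow := fun L => transfer_power w11 w12 w21 w22 xi L n hdet htr).
  cbv zeta in Pow. assert (Q := ChebU_quadratic n xi).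
  set (u := ChebU n xi) in *. set (v := ChebU_pred n xi) in *.
  assert (D : (u * w11 - v) * (u * w22 - v) - (u * w12) * (u * w21) = 1).
  { transitivity (u ^ 2 * (w11 * w22 - w12 * w21) - (w11 + w22) * u * v + v ^ 2); [ring|].
    rewrite hdet, htr. lra. }
  split.
  - destruct (total_transfer_exists _ _ _ _ D) as (r & z & Z).
    set (y := k * (INR (S n) * h)).
    exists r, (z * expi (- y))%C. apply Eq.
    exists (fun j => Nat.iter j (transfer w11 w12 w21 w22) ((1 + r)%C, (Ci * (1 - r))%C)).
    split; [reflexivity|]. split; [|reflexivity].
    rewrite (Pow (fun j => Nat.iter j (transfer w11 w12 w21 w22) _)) by reflexivity.
    cbv beta. simpl Nat.iter. rewrite <- Z. fold y.
    replace (z * expi (- y) * expi y)%C with z; [reflexivity|].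
    unfold expi. rewrite cos_neg, sin_neg.
    assert (Ey := sin2_cos2 y). unfold Rsqr in Ey. destruct z as [z1 z2].
    apply injective_projections; simpl.
    + transitivity (z1 * (sin y * sin y + cos y * cos y)); [rewrite Ey|]; ring.
    + transitivity (z2 * (sin y * sin y + cos y * cos y)); [rewrite Ey|]; ring.
  - intros r t Hc. apply Eq in Hc as (L & L0 & LN & H).
    assert (Hn : forall j, (j <= n)%nat -> L (S j) = transfer w11 w12 w21 w22 (L j))
      by (intros j hj; apply H; lia).
    assert (Z := Pow L Hn). rewrite L0, LN in Z.
    apply (total_transfer_modulus _ _ _ _ _ _ D) in Z.
    rewrite Cmod_mult, Cmod_expi, Rmult_1_r in Z. rewrite Z.
    (* This quantity is unchanged by the rotation and can be computed on the vertex
       matrix (a, 0; -g, 1/a) alone. *)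
    assert (F : (w11 - w22) ^ 2 + (w12 + w21) ^ 2
                = ((th1 ^ 2 - th2 ^ 2) ^ 2 + m ^ 2 * th3 ^ 4) / (th1 ^ 2 * th2 ^ 2)).
    { transitivity ((a - / a) ^ 2 * (sin (k * h) * sin (k * h) + cos (k * h) * cos (k * h))
                    + g ^ 2 * (sin (k * h) * sin (k * h) + cos (k * h) * cos (k * h))).
      - unfold w11, w12, w21, w22. now field.
      - rewrite E. unfold a, g. field. now split. }
    assert (P : 0 <= ((th1 ^ 2 - th2 ^ 2) ^ 2 + m ^ 2 * th3 ^ 4) / (4 * th1 ^ 2 * th2 ^ 2)).
    { replace (((th1 ^ 2 - th2 ^ 2) ^ 2 + m ^ 2 * th3 ^ 4) / (4 * th1 ^ 2 * th2 ^ 2))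
        with (((w11 - w22) ^ 2 + (w12 + w21) ^ 2) / 4)
        by (rewrite F; field; now split).
      generalize (pow2_ge_0 (w11 - w22)) (pow2_ge_0 (w12 + w21)). lra. }
    set (X := ((th1 ^ 2 - th2 ^ 2) ^ 2 + m ^ 2 * th3 ^ 4) / (4 * th1 ^ 2 * th2 ^ 2)) in *.
    assert (FX : (w11 - w22) ^ 2 + (w12 + w21) ^ 2 = 4 * X).
    { rewrite F. unfold X. field. now split. }
    replace (4 + (u * w11 - v - (u * w22 - v)) ^ 2 + (u * w12 + u * w21) ^ 2)
      with (4 * (1 + X * u ^ 2)).
    + assert (0 <= X * u ^ 2) by (apply Rmult_le_pos; [trivial|apply pow2_ge_0]).
      field. lra.
    + transitivity (4 + (4 * X) * u ^ 2); [ring|]. rewrite <- FX. ring.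
Qed.

(** The change of parameters made by the duality. It sends xi to the negative of
    the argument below, and U_n is an even or an odd function. *)
Lemma transmission_opp (N : nat) (h th1 th2 th3 m k : R) :
  th1 * th2 <> 0 ->
  transmission N h (- th1) th2 th3 (- m) k =
  1 / (1 + ((th1 ^ 2 - th2 ^ 2) ^ 2 + m ^ 2 * th3 ^ 4) / (4 * th1 ^ 2 * th2 ^ 2)
           * ChebU (N - 1)
               (((th1 ^ 2 + th2 ^ 2) * cos (k * h) + m * th3 ^ 2 * sin (k * h))
                / (2 * th1 * th2)) ^ 2).
Proof.
  intros h12.
  assert (h1 : th1 <> 0) by (intros e; apply h12; rewrite e; ring).
  assert (h2 : th2 <> 0) by (intros e; apply h12; rewrite e; ring).
  unfold transmission. rewrite <- ChebU_opp.
  replace (- ((((- th1) ^ 2 + th2 ^ 2) * cos (k * h) - - m * th3 ^ 2 * sin (k * h))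
              / (2 * - th1 * th2)))
    with (((th1 ^ 2 + th2 ^ 2) * cos (k * h) + m * th3 ^ 2 * sin (k * h)) / (2 * th1 * th2))
    by (field; now split).
  now replace ((- th1) ^ 2) with (th1 ^ 2) by ring; replace ((- m) ^ 2) with (m ^ 2) by ring.
Qed.

(** * Vertices that block the channel *)

(** For den = 0, that is at a pole of mu, the resonator pins its foot to zero, and
    th3 <> 0 transmits this to both channel edges. *)
Definition blocking (th1 th2 th3 den : R) : Prop :=
  th1 * th2 = 0 \/ (den = 0 /\ th3 <> 0).

(** The slope of the outgoing wave is i k times its value, whereas the parameters of
    the vertex and of the resonator are real: this is what excludes transmission
    when th1 = 0. *)
Lemma nonreal_factor (x y : R) : x <> 0 -> (Ci * RtoC x + RtoC y)%C <> 0%C.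
Proof.
  intros hx H. apply (f_equal snd) in H. unfold Ci in H. simpl in H. lra.
Qed.

(** Let c be the common ratio at the last vertex, so that the outgoing wave has
    value th2 c there. If th2 <> 0 and th1 = 0, the outgoing wave and the resonator
    balance their slopes alone, (i th2^2 den + th3^2 num) c = 0, and c = 0. *)
Lemma blocking_no_transmission (N : nat) (h th1 th2 th3 den num k : R) (r t : C) :
  (1 <= N)%nat -> blocking th1 th2 th3 den -> 0 < num ^ 2 + den ^ 2 ->
  scattering_chain N h TypeI th1 th2 th3 den num k r t -> t = 0%C.
Proof.
  intros hN hb hnd (a & _ & aN & H). destruct N as [|n]; [lia|].
  specialize (H n (Nat.lt_succ_diag_r n)). rewrite aN in H.
  unfold channel_relation in H.
  destruct H as [b [E W]].
  assert (R1 := rotate_harmonic k (INR n * h) (t, (Ci * t)%C)).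
  rewrite rotate_outgoing in R1. apply pair_equal_spec in R1 as [Ew Ew'].
  rewrite <- Ew in E. rewrite <- Ew' in W. unfold weighted_sum_zero in W.
  set (w := (t * expi (k * (INR n * h)))%C) in *.
  assert (hw : w = 0%C -> t = 0%C).
  { intros K. apply Cmod_eq_0. apply (f_equal Cmod) in K. unfold w in K.
    now rewrite Cmod_mult, Cmod_expi, Rmult_1_r, Cmod_0 in K. }
  apply hw. apply equal_ratios_iff_proportional in E as (c & _ & E2 & E3).
  assert (cancel : forall x y : C, x <> 0%C -> (x * y = 0)%C -> y = 0%C).
  { intros x y hx K. transitivity (/ x * (x * y))%C; [now field|rewrite K; ring]. }
  destruct (Req_dec th2 0) as [e2|n2]; [rewrite E2, e2; ring|].
  enough (K : c = 0%C) by (rewrite E2, K; ring).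
  destruct (Req_dec den 0) as [e|nd].
  - destruct (Req_dec th3 0) as [e3|n3].
    + assert (e1 : th1 = 0) by (destruct hb as [K|K]; [|tauto]; apply Rmult_integral in K; tauto).
      rewrite e1, e3, E2 in W. apply (cancel (Ci * RtoC (th2 * th2) + RtoC 0)%C).
      * apply nonreal_factor. now apply Rmult_integral_contrapositive.
      * etransitivity; [|exact W]. rewrite RtoC_mult. ring.
    + apply (cancel (RtoC th3)); [now apply RtoC_neq_0|]. rewrite <- E3, e. ring.
  - assert (e1 : th1 = 0) by (destruct hb as [K|K]; [|tauto]; apply Rmult_integral in K; tauto).
    rewrite e1, E2 in W.
    apply (cancel (Ci * RtoC (th2 * th2 * den) + RtoC (th3 * th3 * num))%C).
    + apply nonreal_factor. repeat apply Rmult_integral_contrapositive_currified; trivial.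
    + transitivity (RtoC den * (RtoC 0 * - harmonic k (turn (a n)) (INR n * h)
         + RtoC th2 * (Ci * (RtoC th2 * c)) + RtoC th3 * (b * RtoC num)))%C; [|rewrite W; ring].
      transitivity (Ci * RtoC (th2 * th2 * den) * c + RtoC th3 * RtoC num * (RtoC th3 * c))%C;
        [rewrite !RtoC_mult; ring|].
      rewrite <- E3, !RtoC_mult. ring.
Qed.

(** The wave may be taken to be zero on every channel edge but the incoming lead:
    what is left is a problem for r and the amplitude b of the first resonator. *)
Lemma blocking_chain_exists (N : nat) (h th1 th2 th3 den num k : R) :
  (1 <= N)%nat -> blocking th1 th2 th3 den -> 0 < num ^ 2 + den ^ 2 ->
  exists r, scattering_chain N h TypeI th1 th2 th3 den num k r 0%C.
Proof.
  intros hN hb hnd.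
  enough (V : exists (r b : C),
    vertex_condition TypeI th1 th2 th3 (1 + r)%C 0%C (b * RtoC den)%C
      (- (Ci * (1 - r)))%C 0%C (b * RtoC num)%C).
  { destruct V as (r & b & V). exists r.
    exists (fun j => match j with O => ((1 + r)%C, (Ci * (1 - r))%C) | S _ => (RtoC 0, RtoC 0) end).
    assert (H0 : forall x, harmonic k (RtoC 0, RtoC 0) x = 0%C)
      by (intros x; unfold harmonic; simpl; ring).
    assert (T0 : turn (RtoC 0, RtoC 0) = (RtoC 0, RtoC 0)) by (unfold turn; simpl; f_equal; ring).
    split; [reflexivity|]. split.
    - destruct N; [lia|]. f_equal; ring.
    - intros [|j] _; unfold channel_relation, vertex_relation; rewrite ?T0, ?H0.
      + exists b. simpl INR. now rewrite Rmult_0_l, !harmonic_at_0.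
      + exists 0%C. simpl. unfold weighted_sum_zero. rewrite equal_ratios_iff_proportional.
        split; [exists 0%C; repeat split; ring|ring]. }
  simpl. unfold weighted_sum_zero.
  enough (V : exists c b r : C, (1 + r = RtoC th1 * c)%C /\ (RtoC 0 = RtoC th2 * c)%C /\
    (b * RtoC den = RtoC th3 * c)%C /\
    (RtoC th1 * - (Ci * (1 - r)) + RtoC th3 * (b * RtoC num) = 0)%C).
  { destruct V as (c & b & r & E1 & E2 & E3 & W). exists r, b. split.
    - apply equal_ratios_iff_proportional. now exists c.
    - etransitivity; [|exact W]. ring. }
  destruct (Req_dec th1 0) as [e1|n1].
  { exists 0%C, 0%C, (- (1))%C. rewrite e1. repeat split; ring. }
  assert (H1 := RtoC_neq_0 _ n1).
  destruct (Req_dec den 0) as [e|nd]; [destruct (Req_dec th3 0) as [e3|n3]|].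
  - assert (e2 : th2 = 0) by (destruct hb as [K|K]; [|tauto]; apply Rmult_integral in K; tauto).
    exists (2 / RtoC th1)%C, 0%C, 1%C. rewrite e2, e3. repeat split; try ring. now field.
  - assert (nn : num <> 0) by (intros e'; rewrite e, e' in hnd; simpl in hnd; lra).
    assert (Hn := RtoC_neq_0 _ nn). assert (H3 := RtoC_neq_0 _ n3).
    exists 0%C, (2 * Ci * RtoC th1 / (RtoC th3 * RtoC num))%C, (- (1))%C. rewrite e.
    repeat split; try ring. field. now split.
  - assert (e2 : th2 = 0) by (destruct hb as [K|K]; [|tauto]; apply Rmult_integral in K; tauto).
    set (q := (Ci * RtoC (th1 * th1 * den) + RtoC (th3 * th3 * num))%C).
    assert (hq : q <> 0%C)
      by (apply nonreal_factor; repeat apply Rmult_integral_contrapositive_currified; trivial).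
    set (c := (2 * Ci * RtoC th1 * RtoC den / q)%C).
    exists c, (2 * Ci * RtoC th1 * RtoC th3 / q)%C, (RtoC th1 * c - 1)%C.
    rewrite e2. unfold c. repeat split; try ring; try (field; trivial).
    assert (Eq : q = (Ci * (RtoC th1 * RtoC th1 * RtoC den)
                       + RtoC th3 * RtoC th3 * RtoC num)%C)
      by (unfold q; rewrite !RtoC_mult; ring).
    transitivity (2 * Ci * RtoC th1 * (- q + (Ci * (RtoC th1 * RtoC th1 * RtoC den)
                   + RtoC th3 * RtoC th3 * RtoC num)) / q)%C; [field; trivial|].
    rewrite <- Eq. now field.
Qed.

(** * Transmission probabilities of chains *)

Definition chain_probability (N : nat) (h : R) (vt : vertex_type)
    (th1 th2 th3 den num k T : R) : Prop :=
  (exists r t, scattering_chain N h vt th1 th2 th3 den num k r t) /\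
  (forall r t, scattering_chain N h vt th1 th2 th3 den num k r t -> T = Cmod t ^ 2).

Lemma chain_probability_is_transmission (N : nat) (h l : R) (vt : vertex_type)
    (th1 th2 th3 alpha beta k T : R) :
  (1 <= N)%nat -> 0 < h -> 0 < l -> (alpha, beta) <> (0, 0) -> k <> 0 ->
  chain_probability N h vt th1 th2 th3 (mu_den l alpha beta k) (mu_num l alpha beta k) k T ->
  is_transmission_probability N h l vt th1 th2 th3 alpha beta k T.
Proof.
  intros hN hh hl hab hk [(r & t & Hc) Hu]. split.
  - destruct (scattering_solution_of_chain N h l vt th1 th2 th3 alpha beta k r t hh hl hk Hc)
      as [psi Hpsi].
    now exists psi, r, t.
  - intros psi r' t' Hs. apply (Hu r').
    now apply (chain_of_scattering_solution N h l vt th1 th2 th3 alpha beta k psi).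
Qed.

Lemma chain_probability_dual (N : nat) (h th1 th2 th3 den num k T : R) :
  chain_probability N h TypeI (- th1) th2 th3 num (- den) k T ->
  chain_probability N h TypeII th1 th2 th3 den num k T.
Proof.
  intros [(r & t & Hc) Hu]. split.
  - exists (- r)%C, t. apply scattering_chain_dual.
    now replace (- - r)%C with r by ring.
  - intros r' t' Hs. apply scattering_chain_dual in Hs. now apply (Hu (- r')%C).
Qed.

Lemma chain_probability_regular (N : nat) (h th1 th2 th3 den num k : R) :
  (1 <= N)%nat -> th1 * th2 <> 0 -> den <> 0 \/ th3 = 0 ->
  chain_probability N h TypeI th1 th2 th3 den num k
    (transmission N h th1 th2 th3 (num / den) k).
Proof.
  intros hN h12 hd.
  destruct (scattering_chain_transmission N h th1 th2 th3 den num k hN h12 hd) as [He Hu].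
  split; [exact He|]. intros r t Hc. symmetry. now apply (Hu r).
Qed.

Lemma chain_probability_blocking (N : nat) (h th1 th2 th3 den num k : R) :
  (1 <= N)%nat -> blocking th1 th2 th3 den -> 0 < num ^ 2 + den ^ 2 ->
  chain_probability N h TypeI th1 th2 th3 den num k 0.
Proof.
  intros hN hb hnd. split.
  - destruct (blocking_chain_exists N h th1 th2 th3 den num k hN hb hnd) as [r Hr].
    now exists r, (RtoC 0).
  - intros r t Hc.
    rewrite (blocking_no_transmission N h th1 th2 th3 den num k r t hN hb hnd Hc), Cmod_0.
    ring.
Qed.

(** * The formula at the exceptional wavenumbers *)

Lemma ex_derive_ChebU (n : nat) (xi : R) : ex_derive (ChebU n) xi.
Proof.
  enough (E : ex_derive (ChebU n) xi /\ ex_derive (ChebU_pred n) xi) by apply E.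
  induction n as [|n [IH1 IH2]].
  - split; apply ex_derive_const.
  - split; [|exact IH1].
    apply (ex_derive_ext (fun y => 2 * y * ChebU n y - ChebU_pred n y)).
    + intros y. symmetry. apply ChebU_S.
    + auto_derive. now split.
Qed.

Lemma four_squares_pos (x y : R) : x * y <> 0 -> 0 < 4 * x ^ 2 * y ^ 2.
Proof.
  intros hxy. replace (4 * x ^ 2 * y ^ 2) with (4 * (x * y) ^ 2) by ring.
  generalize (pow2_gt_0 _ hxy). lra.
Qed.

Lemma transmission_denominator_pos (th1 th2 th3 m u : R) :
  th1 * th2 <> 0 ->
  0 < 1 + ((th1 ^ 2 - th2 ^ 2) ^ 2 + m ^ 2 * th3 ^ 4) / (4 * th1 ^ 2 * th2 ^ 2) * u ^ 2.
Proof.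
  intros h12.
  assert (P := four_squares_pos th1 th2 h12).
  assert (Q : 0 <= (th1 ^ 2 - th2 ^ 2) ^ 2 + m ^ 2 * th3 ^ 4).
  { replace (m ^ 2 * th3 ^ 4) with ((m * th3 ^ 2) ^ 2) by ring.
    generalize (pow2_ge_0 (th1 ^ 2 - th2 ^ 2)) (pow2_ge_0 (m * th3 ^ 2)). lra. }
  assert (0 <= ((th1 ^ 2 - th2 ^ 2) ^ 2 + m ^ 2 * th3 ^ 4) / (4 * th1 ^ 2 * th2 ^ 2) * u ^ 2).
  { apply Rmult_le_pos; [|apply pow2_ge_0]. apply Rmult_le_pos; [exact Q|].
    left. now apply Rinv_0_lt_compat. }
  lra.
Qed.

(** For th3 = 0 the formula is independent of mu, hence continuous at its poles. *)
Lemma transmission_decoupled_limit (N : nat) (h th1 th2 : R) (m : R -> R) (k : R) :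
  th1 * th2 <> 0 ->
  is_lim (fun y => transmission N h th1 th2 0 (m y) y) k (transmission N h th1 th2 0 (m k) k).
Proof.
  intros h12.
  assert (E : forall y, transmission N h th1 th2 0 0 y = transmission N h th1 th2 0 (m y) y).
  { intros y. unfold transmission.
    now replace (m y ^ 2 * 0 ^ 4) with (0 ^ 2 * 0 ^ 4) by ring;
      replace (m y * 0 ^ 2 * sin (y * h)) with (0 * 0 ^ 2 * sin (y * h)) by ring. }
  rewrite <- E. apply (is_lim_ext _ _ _ _ E).
  apply is_lim_continuity, continuity_pt_filterlim.
  apply (ex_derive_continuous (transmission N h th1 th2 0 0)).
  unfold transmission. auto_derive. split.
  - apply ex_derive_ChebU.
  - split; [|easy].
    apply Rgt_not_eq. generalize (transmission_denominator_pos th1 th2 0 0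
      (ChebU (N - 1) (((th1 ^ 2 + th2 ^ 2) * cos (k * h) - 0 * 0 ^ 2 * sin (k * h))
                      / (2 * th1 * th2))) h12).
    unfold Rdiv. simpl. intros H. exact H.
Qed.

Lemma sign_near_simple_zero (g : R -> R) (x d : R) :
  is_derive g x d -> g x = 0 -> 0 < d ->
  locally' x (fun y => 0 < (y - x) * g y).
Proof.
  intros Hg g0 hd. apply is_derive_Reals in Hg.
  destruct (Hg d hd) as [delta H].
  enough (Q : forall y : R, Rabs (y - x) < delta -> y <> x -> 0 < (y - x) * g y)
    by (exists delta; exact Q).
  intros y By ne.
  assert (ny : y - x <> 0) by lra.
  specialize (H (y - x) ny). replace (x + (y - x)) with y in H by ring.
  rewrite g0, Rminus_0_r in H.
  assert (Q : Rabs (g y / (y - x) - d) < d) by now apply H.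
  apply Rabs_def2 in Q.
  replace ((y - x) * g y) with ((y - x) ^ 2 * (g y / (y - x))) by now field.
  apply Rmult_lt_0_compat; [now apply pow2_gt_0|lra].
Qed.

Lemma positive_near (f : R -> R) (x : R) :
  ex_derive f x -> 0 < f x -> locally x (fun y => 0 < f y).
Proof.
  intros D P. apply (ex_derive_continuous f) in D.
  apply (D (fun z => 0 < z)). exact (open_gt 0 (f x) P).
Qed.

(** A consequence of th1^2 + th2^2 >= 2 |th1 th2|. *)
Lemma band_edge (th1 th2 c e : R) :
  th1 * th2 <> 0 ->
  (th1 ^ 2 + th2 ^ 2) ^ 2 <= ((th1 ^ 2 + th2 ^ 2) * c + e) ^ 2 ->
  1 <= (((th1 ^ 2 + th2 ^ 2) * c + e) / (2 * th1 * th2)) ^ 2.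
Proof.
  intros h12 H.
  assert (h1 : th1 <> 0) by (intros K; apply h12; rewrite K; ring).
  assert (h2 : th2 <> 0) by (intros K; apply h12; rewrite K; ring).
  assert (P : 0 < (2 * th1 * th2) ^ 2)
    by (apply pow2_gt_0; repeat apply Rmult_integral_contrapositive_currified; trivial; lra).
  replace ((((th1 ^ 2 + th2 ^ 2) * c + e) / (2 * th1 * th2)) ^ 2)
    with (((th1 ^ 2 + th2 ^ 2) * c + e) ^ 2 / (2 * th1 * th2) ^ 2) by (field; now split).
  apply Rle_div_r; [exact P|].
  generalize (pow2_ge_0 (th1 ^ 2 - th2 ^ 2)). lra.
Qed.

(** The hypothesis on the sign of [d * num k] says that num / den has a simple pole
    with negative residue at k. Near the pole |xi| >= 1, hence U^2 >= 1, and the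
    formula lies between 0 and the function [G], which vanishes at k. *)
Lemma transmission_resonance_limit (N : nat) (h th1 th2 th3 : R) (num den : R -> R)
    (k d : R) :
  0 < h -> th1 * th2 <> 0 -> th3 <> 0 ->
  ex_derive num k -> is_derive den k d -> den k = 0 -> d * num k < 0 ->
  is_lim (fun y => transmission N h th1 th2 th3 (num y / den y) y) k 0.
Proof.
  intros hh h12 h3 Dn Dd dk hneg.
  assert (h1 : th1 <> 0) by (intros K; apply h12; rewrite K; ring).
  assert (h2 : th2 <> 0) by (intros K; apply h12; rewrite K; ring).
  assert (nk : num k <> 0) by (intros K; rewrite K in hneg; lra).
  assert (Ed : ex_derive den k) by now exists d.
  set (S := th1 ^ 2 + th2 ^ 2).
  assert (hS : 0 < S) by (unfold S; generalize (pow2_gt_0 _ h1) (pow2_ge_0 th2); lra).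
  assert (P3 : 0 < th3 ^ 4)
    by (replace (th3 ^ 4) with ((th3 ^ 2) ^ 2) by ring; apply pow2_gt_0; now apply pow_nonzero).
  assert (Pn : 0 < num k ^ 2) by now apply pow2_gt_0.
  pose (G := fun y => 4 * th1 ^ 2 * th2 ^ 2 * den y ^ 2 / (num y ^ 2 * th3 ^ 4)).
  assert (EG : ex_derive G k).
  { unfold G. auto_derive. repeat split; trivial.
    generalize (Rmult_lt_0_compat _ _ Pn P3). simpl. lra. }
  assert (LG : is_lim G k 0).
  { replace (Finite 0) with (Finite (G k))
      by (unfold G; rewrite dk; f_equal; unfold Rdiv; ring).
    apply is_lim_continuity, continuity_pt_filterlim. now apply (ex_derive_continuous G). }
  assert (N1 : locally' k (fun y => 0 < (y - k) * - (den y * num y))).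
  { apply (sign_near_simple_zero _ k (- (d * num k))).
    - replace (- (d * num k)) with (- (Derive den k * num k + den k * Derive num k)).
      + auto_derive; [now repeat split|].
        change (Derive (fun x => den x) k) with (Derive den k).
        change (Derive (fun x => num x) k) with (Derive num k). ring.
      + rewrite dk, (is_derive_unique _ _ _ Dd). ring.
    - rewrite dk; ring.
    - lra. }
  assert (N2 : locally' k (fun y =>
     S ^ 2 <= (S * cos (y * h) + - (num y / den y * th3 ^ 2 * sin (y * h))) ^ 2)).
  { assert (Esc : forall y, sin (y * h) ^ 2 + cos (y * h) ^ 2 = 1).
    { intros y. generalize (sin2_cos2 (y * h)). unfold Rsqr. intros E. simpl. lra. }
    destruct (Req_dec (sin (k * h)) 0) as [s0|sn].
    (* With S = th1^2 + th2^2 and e = -mu th3^2 sin: the product e cos is nonnegative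
       by the sign of the residue, and e^2 >= S^2 sin^2 because |mu| is large, so
       that (S cos + e)^2 >= S^2 cos^2 + S^2 sin^2. *)
    - assert (N3 : locally' k (fun y => 0 < (y - k) * (sin (y * h) * cos (y * h)))).
      { apply (sign_near_simple_zero _ k h); [|rewrite s0; ring|exact hh].
        auto_derive; [easy|]. specialize (Esc k). rewrite s0 in Esc |- *.
        transitivity (h * cos (k * h) ^ 2); [ring|].
        replace (cos (k * h) ^ 2) with 1 by lra. ring. }
      assert (N4 : locally' k (fun y => 0 < num y ^ 2 * th3 ^ 4 - S ^ 2 * den y ^ 2)).
      { apply filter_le_within, positive_near.
        - auto_derive. now repeat split.
        - rewrite dk. generalize (Rmult_lt_0_compat _ _ Pn P3). lra. }
      generalize (filter_and _ _ N1 (filter_and _ _ N3 N4)). apply filter_imp.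
      intros y (H1 & H3 & H4).
      assert (nd : den y <> 0) by (intros K; rewrite K in H1; lra).
      assert (Pd : 0 < den y ^ 2) by now apply pow2_gt_0.
      set (e := - (num y / den y * th3 ^ 2 * sin (y * h))).
      assert (He : 0 <= e * cos (y * h)).
      { replace (e * cos (y * h))
          with (th3 ^ 2 * (- (den y * num y) * (sin (y * h) * cos (y * h))) / den y ^ 2)
          by (unfold e; field; trivial).
        apply Rmult_le_pos; [|left; now apply Rinv_0_lt_compat].
        apply Rmult_le_pos; [apply pow2_ge_0|].
        assert (X := Rmult_lt_0_compat _ _ H1 H3).
        assert (ny : y - k <> 0) by (intros K; rewrite K in H1; lra).
        assert (Py : 0 < (y - k) ^ 2) by now apply pow2_gt_0.
        left. apply (Rmult_lt_reg_l _ _ _ Py). lra. }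
      assert (Hs : S ^ 2 * sin (y * h) ^ 2 <= e ^ 2).
      { replace (e ^ 2) with (num y ^ 2 * th3 ^ 4 / den y ^ 2 * sin (y * h) ^ 2)
          by (unfold e; field; trivial).
        apply Rmult_le_compat_r; [apply pow2_ge_0|].
        apply (proj1 (Rle_div_r _ _ _ Pd)). lra. }
      replace (S ^ 2) with (S ^ 2 * (sin (y * h) ^ 2 + cos (y * h) ^ 2))
        by (rewrite Esc; ring).
      assert (0 <= S * (e * cos (y * h))) by (apply Rmult_le_pos; lra). lra.
    (* Here |e| is large, and |S cos + e| >= |e| - S is at least S as soon as
       |e| >= 2 S. *)
    - assert (Ps : 0 < sin (k * h) ^ 2) by now apply pow2_gt_0.
      assert (N4 : locally' k (fun y =>
        0 < num y ^ 2 * th3 ^ 4 * sin (y * h) ^ 2 - 4 * S ^ 2 * den y ^ 2)).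
      { apply filter_le_within, positive_near.
        - auto_derive. now repeat split.
        - rewrite dk.
          generalize (Rmult_lt_0_compat _ _ (Rmult_lt_0_compat _ _ Pn P3) Ps). lra. }
      generalize (filter_and _ _ N1 N4). apply filter_imp.
      intros y (H1 & H4).
      assert (nd : den y <> 0) by (intros K; rewrite K in H1; lra).
      assert (Pd : 0 < den y ^ 2) by now apply pow2_gt_0.
      set (e := - (num y / den y * th3 ^ 2 * sin (y * h))).
      assert (Hs : (2 * S) ^ 2 <= e ^ 2).
      { replace (e ^ 2) with (num y ^ 2 * th3 ^ 4 * sin (y * h) ^ 2 / den y ^ 2)
          by (unfold e; field; trivial).
        apply (proj1 (Rle_div_r _ _ _ Pd)). lra. }
      assert (C := COS_bound (y * h)).
      rewrite <- (pow2_abs e) in Hs. rewrite <- (pow2_abs (S * cos (y * h) + e)).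
      assert (A1 := Rabs_pos e).
      assert (A2 : 2 * S <= Rabs e) by nra.
      assert (A3 : Rabs (S * cos (y * h)) <= S) by (apply Rabs_le; nra).
      assert (A4 := Rabs_triang_inv e (- (S * cos (y * h)))).
      rewrite Rabs_Ropp in A4.
      replace (e - - (S * cos (y * h))) with (S * cos (y * h) + e) in A4 by ring.
      nra. }
  apply (is_lim_le_le_loc (fun _ => 0) G); [|apply is_lim_const|exact LG].
  generalize (filter_and _ _ N1 N2). apply filter_imp.
  intros y (H1 & H2).
  assert (nd : den y <> 0) by (intros K; rewrite K in H1; lra).
  assert (nn : num y <> 0) by (intros K; rewrite K in H1; lra).
  unfold S in H2. apply (band_edge th1 th2 (cos (y * h)) _ h12) in H2.
  change ((th1 ^ 2 + th2 ^ 2) * cos (y * h) + - (num y / den y * th3 ^ 2 * sin (y * h)))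
    with ((th1 ^ 2 + th2 ^ 2) * cos (y * h) - num y / den y * th3 ^ 2 * sin (y * h)) in H2.
  apply (ChebU_large (N - 1)) in H2.
  unfold transmission.
  set (u := ChebU (N - 1) _) in *.
  assert (Dp := transmission_denominator_pos th1 th2 th3 (num y / den y) u h12).
  split.
  - left. apply Rdiv_lt_0_compat; [exact Rlt_0_1|exact Dp].
  - assert (PB : 0 < num y ^ 2 * th3 ^ 4 / (4 * th1 ^ 2 * th2 ^ 2 * den y ^ 2)).
    { apply Rdiv_lt_0_compat.
      - apply Rmult_lt_0_compat; [now apply pow2_gt_0|exact P3].
      - apply Rmult_lt_0_compat; [now apply four_squares_pos|now apply pow2_gt_0]. }
    replace (G y) with (/ (num y ^ 2 * th3 ^ 4 / (4 * th1 ^ 2 * th2 ^ 2 * den y ^ 2)))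
      by (unfold G; field; repeat split; trivial).
    unfold Rdiv at 1. rewrite Rmult_1_l. apply Rinv_le_contravar; [exact PB|].
    assert (Pd := pow2_gt_0 _ nd).
    assert (PA : 0 <= (th1 ^ 2 - th2 ^ 2) ^ 2 / (4 * th1 ^ 2 * th2 ^ 2)).
    { apply Rmult_le_pos; [apply pow2_ge_0|]. left. now apply Rinv_0_lt_compat, four_squares_pos. }
    replace (((th1 ^ 2 - th2 ^ 2) ^ 2 + (num y / den y) ^ 2 * th3 ^ 4) / (4 * th1 ^ 2 * th2 ^ 2))
      with ((th1 ^ 2 - th2 ^ 2) ^ 2 / (4 * th1 ^ 2 * th2 ^ 2)
            + num y ^ 2 * th3 ^ 4 / (4 * th1 ^ 2 * th2 ^ 2 * den y ^ 2))
      by (field; repeat split; trivial).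
    nra.
Qed.

(** * The sign of the residues of mu and 1/mu *)

Lemma sin_cos_lt (y : R) : 0 < y -> - y < sin y * cos y < y.
Proof.
  intros hy. assert (E := sin_2a y).
  assert (U : sin (2 * y) < 2 * y) by (apply sin_lt_x; lra).
  assert (V : - (2 * y) < sin (2 * y)).
  { destruct (Rlt_le_dec (2 * y) PI) as [L|L].
    - assert (0 < sin (2 * y)) by (apply sin_gt_0; lra). lra.
    - assert (B := SIN_bound (2 * y)). assert (P := PI2_1). lra. }
  lra.
Qed.

Lemma is_derive_mu_den (l alpha beta k : R) :
  is_derive (mu_den l alpha beta) k
    (beta * cos (k * l) - beta * k * l * sin (k * l) + alpha * l * cos (k * l)).
Proof. unfold mu_den. auto_derive; [easy|]. ring. Qed.

Lemma is_derive_mu_num (l alpha beta k : R) :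
  is_derive (mu_num l alpha beta) k
    (beta * sin (k * l) + beta * k * l * cos (k * l) + alpha * l * sin (k * l)).
Proof. unfold mu_num. auto_derive; [easy|]. ring. Qed.

(** At a pole beta k = M sin(kl) and alpha = -M cos(kl) with M = mu_num, and k times
    the product equals -M^2 (kl - sin(kl) cos(kl)). *)
Lemma mu_pole_sign (l alpha beta k : R) :
  0 < l -> 0 < k -> (alpha, beta) <> (0, 0) -> mu_den l alpha beta k = 0 ->
  (beta * cos (k * l) - beta * k * l * sin (k * l) + alpha * l * cos (k * l))
    * mu_num l alpha beta k < 0.
Proof.
  intros hl hk hab hd.
  assert (P := mu_sq_sum_pos l alpha beta k hab (Rgt_not_eq _ _ hk)). rewrite hd in P.
  assert (T := sin_cos_lt (k * l) (Rmult_lt_0_compat _ _ hk hl)).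
  assert (E := sin2_cos2 (k * l)). unfold Rsqr in E.
  unfold mu_den in hd. unfold mu_num in *.
  set (s := sin (k * l)) in *. set (c := cos (k * l)) in *.
  set (M := beta * k * s - alpha * c) in *.
  assert (Eb : beta * k = M * s).
  { transitivity (beta * k * (s * s + c * c) - c * (beta * k * c + alpha * s));
      [rewrite E, hd|unfold M]; ring. }
  assert (Ea : alpha = - (M * c)).
  { transitivity (alpha * (s * s + c * c) - s * (beta * k * c + alpha * s));
      [rewrite E, hd|unfold M]; ring. }
  apply (Rmult_lt_reg_l k); [exact hk|].
  replace (k * ((beta * c - beta * k * l * s + alpha * l * c) * M))
    with ((beta * k) * c * M - (beta * k) * k * l * s * M + alpha * k * l * c * M) by ring.
  rewrite Eb, Ea.
  replace (M * s * c * M - M * s * k * l * s * M + - (M * c) * k * l * c * M)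
    with (M ^ 2 * (s * c - k * l * (s * s + c * c))) by ring.
  rewrite E. assert (0 < M ^ 2) by lra. nra.
Qed.

(** The counterpart for -1/mu at a zero of mu: there beta k = D cos(kl) and
    alpha = D sin(kl) with D = mu_den, and k times the product equals
    -D^2 (kl + sin(kl) cos(kl)). *)
Lemma mu_zero_sign (l alpha beta k : R) :
  0 < l -> 0 < k -> (alpha, beta) <> (0, 0) -> mu_num l alpha beta k = 0 ->
  (beta * sin (k * l) + beta * k * l * cos (k * l) + alpha * l * sin (k * l))
    * - mu_den l alpha beta k < 0.
Proof.
  intros hl hk hab hd.
  assert (P := mu_sq_sum_pos l alpha beta k hab (Rgt_not_eq _ _ hk)). rewrite hd in P.
  assert (T := sin_cos_lt (k * l) (Rmult_lt_0_compat _ _ hk hl)).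
  assert (E := sin2_cos2 (k * l)). unfold Rsqr in E.
  unfold mu_num in hd. unfold mu_den in *.
  set (s := sin (k * l)) in *. set (c := cos (k * l)) in *.
  set (D := beta * k * c + alpha * s) in *.
  assert (Eb : beta * k = D * c).
  { transitivity (beta * k * (s * s + c * c) - s * (beta * k * s - alpha * c));
      [rewrite E, hd|unfold D]; ring. }
  assert (Ea : alpha = D * s).
  { transitivity (alpha * (s * s + c * c) + c * (beta * k * s - alpha * c));
      [rewrite E, hd|unfold D]; ring. }
  apply (Rmult_lt_reg_l k); [exact hk|].
  replace (k * ((beta * s + beta * k * l * c + alpha * l * s) * - D))
    with (- ((beta * k) * s * D + (beta * k) * k * l * c * D + alpha * k * l * s * D)) by ring.
  rewrite Eb, Ea.
  replace (- (D * c * s * D + D * c * k * l * c * D + D * s * k * l * s * D))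
    with (- (D ^ 2 * (s * c + k * l * (s * s + c * c)))) by ring.
  rewrite E. assert (0 < D ^ 2) by lra. nra.
Qed.

(** Parts (i) and (ii) are both instances, with num / den equal to mu and to -1/mu.
    At a zero of den either the resonator is decoupled and the formula is
    continuous, or the channel is blocked and the formula tends to 0. *)
Lemma probability_and_limit (N : nat) (h th1 th2 th3 : R) (num den : R -> R) (k d : R) :
  (1 <= N)%nat -> 0 < h -> th1 * th2 <> 0 ->
  ex_derive num k -> is_derive den k d -> (den k = 0 -> d * num k < 0) ->
  exists T,
    chain_probability N h TypeI th1 th2 th3 (den k) (num k) k T /\
    value_or_limit den (fun y => transmission N h th1 th2 th3 (num y / den y) y) k T.
Proof.
  intros hN hh h12 Dn Dd hneg.
  destruct (Req_dec th3 0) as [e3|n3].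
  - exists (transmission N h th1 th2 th3 (num k / den k) k). split.
    + apply chain_probability_regular; tauto.
    + split; [easy|]. intros _. rewrite e3.
      now apply (transmission_decoupled_limit N h th1 th2 (fun y => num y / den y)).
  - destruct (Req_dec (den k) 0) as [e|n].
    + exists 0. split.
      * apply chain_probability_blocking; trivial.
        -- right. now split.
        -- specialize (hneg e). assert (nk : num k <> 0) by (intros K; rewrite K in hneg; lra).
           rewrite e. generalize (pow2_gt_0 _ nk). lra.
      * split; [easy|]. intros _.
        apply (transmission_resonance_limit N h th1 th2 th3 num den k d); auto.
    + exists (transmission N h th1 th2 th3 (num k / den k) k). split.
      * apply chain_probability_regular; tauto.
      * now split.
Qed.

Theorem theorem1 (N : nat) (h l th1 th2 th3 alpha beta : R)
  (hN : (1 <= N)%nat) (hh : 0 < h) (hl : 0 < l)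
  (hab : (alpha, beta) <> (0, 0)) :
  (th1 * th2 <> 0 ->
     forall k : R, 0 < k ->
     exists T : R,
       is_transmission_probability N h l TypeI th1 th2 th3 alpha beta k T /\
       value_or_limit (mu_den l alpha beta)
         (fun k : R =>
            1 / (1 + ((th1 ^ 2 - th2 ^ 2) ^ 2 + mu l alpha beta k ^ 2 * th3 ^ 4)
                       / (4 * th1 ^ 2 * th2 ^ 2)
                     * ChebU (N - 1)
                         (((th1 ^ 2 + th2 ^ 2) * cos (k * h)
                             - mu l alpha beta k * th3 ^ 2 * sin (k * h))
                            / (2 * th1 * th2)) ^ 2))
         k T)
  /\
  (th1 * th2 <> 0 ->
     forall k : R, 0 < k ->
     exists T : R,
       is_transmission_probability N h l TypeII th1 th2 th3 alpha beta k T /\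
       value_or_limit (mu_num l alpha beta)
         (fun k : R =>
            1 / (1 + ((th1 ^ 2 - th2 ^ 2) ^ 2 + mu_inv l alpha beta k ^ 2 * th3 ^ 4)
                       / (4 * th1 ^ 2 * th2 ^ 2)
                     * ChebU (N - 1)
                         (((th1 ^ 2 + th2 ^ 2) * cos (k * h)
                             + mu_inv l alpha beta k * th3 ^ 2 * sin (k * h))
                            / (2 * th1 * th2)) ^ 2))
         k T)
  /\
  (th1 * th2 = 0 ->
     forall (vt : vertex_type) (k : R), k <> 0 ->
       is_transmission_probability N h l vt th1 th2 th3 alpha beta k 0).
Proof.
  split; [|split].
  - intros h12 k hk.
    destruct (probability_and_limit N h th1 th2 th3 (mu_num l alpha beta) (mu_den l alpha beta)
                k _ hN hh h12 (ex_intro _ _ (is_derive_mu_num l alpha beta k))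
                (is_derive_mu_den l alpha beta k) (mu_pole_sign l alpha beta k hl hk hab))
      as (T & HT & HV).
    exists T. split; [|exact HV].
    apply chain_probability_is_transmission; trivial. lra.
  - intros h12 k hk.
    assert (h12' : - th1 * th2 <> 0) by lra.
    destruct (probability_and_limit N h (- th1) th2 th3
                (fun y => - mu_den l alpha beta y) (mu_num l alpha beta)
                k _ hN hh h12'
                (ex_intro _ _ (is_derive_opp _ _ _ (is_derive_mu_den l alpha beta k)))
                (is_derive_mu_num l alpha beta k) (mu_zero_sign l alpha beta k hl hk hab))
      as (T & HT & [HV HL]).
    assert (E : forall y, transmission N h (- th1) th2 th3
                  (- mu_den l alpha beta y / mu_num l alpha beta y) y =
            1 / (1 + ((th1 ^ 2 - th2 ^ 2) ^ 2 + mu_inv l alpha beta y ^ 2 * th3 ^ 4)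
                       / (4 * th1 ^ 2 * th2 ^ 2)
                     * ChebU (N - 1)
                         (((th1 ^ 2 + th2 ^ 2) * cos (y * h)
                             + mu_inv l alpha beta y * th3 ^ 2 * sin (y * h))
                            / (2 * th1 * th2)) ^ 2)).
    { intros y. rewrite <- transmission_opp by trivial.
      unfold mu_inv. f_equal. unfold Rdiv; ring. }
    exists T. split.
    + apply chain_probability_is_transmission; trivial; [lra|].
      now apply chain_probability_dual.
    + split.
      * intros hd. rewrite (HV hd). apply E.
      * intros hd. apply (is_lim_ext _ _ _ _ E). now apply HL.
  - intros h12 vt k hk.
    assert (P := mu_sq_sum_pos l alpha beta k hab hk).
    apply chain_probability_is_transmission; trivial.
    destruct vt.
    + apply chain_probability_blocking; trivial. now left.
    + apply chain_probability_dual, chain_probability_blocking; trivial.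
      * left. lra.
      * replace ((- mu_den l alpha beta k) ^ 2) with (mu_den l alpha beta k ^ 2) by ring. lra.
Qed.
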